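(* Let $\{\phi_k\}_{k\ge1}$ be an orthonormal basis of $\mathbb{H}_1$ such that for each $k$ the set $\{l : |\langle \phi_k, e_l\rangle_1| \neq 0\}$ is finite. For $k\ge 1$ put $A_k = \{ l : |\langle \phi_m, e_l\rangle_1| \neq 0 \text{ for some } 1\le m\le k\}$ and $\delta_k = \inf_{i\in A_k} |\rho_i|$. Let $\mathcal{P}\subset \mathbb{H}_1$ and let $\Pi_n$ denote a sequence of priors defined on a $\sigma$-algebra of $\mathcal{P}$. Let $\varepsilon_n,\xi_n\to 0$ be sequences of positive numbers and $k_n\to\infty$ a sequence of positive integers such that $\sqrt{n}\,\varepsilon_n\to\infty$ as $n\to\infty$ and $$k_n \le c\, n\varepsilon_n^2 \quad\text{and}\quad \frac{\varepsilon_n}{\delta_{k_n}} \le C_1 \xi_n$$ for some $c, C_1>0$ and all $n\ge 1$. Denote by $P_m$ the (orthogonal) projection operator onto the linear span of $\{\phi_k : 1\le k\le m\}$ and let $\mathcal{P}_n$ be a sequence of subsets of $$\{ f\in\mathcal{P} : \|P_{k_n}(f)-f\|_1 \le C_2\xi_n\}$$ for some $C_2>0$. Moreover, assume that there exists $C>0$ such that, for sufficiently large $n$, $$\Pi_n(\mathcal{P}_n^c) \le e^{-(C+4)n\varepsilon_n^2}, \qquad \Pi_n\left(f\in\mathcal{P} : \|Af-Af_0\|_2\le\varepsilon_n\right) \ge e^{-Cn\varepsilon_n^2}.$$ Suppose that $Y=Y^{(n)}$ has law $\mathbb{P}_{f_0}$, where $f_0\in\mathbb{H}_1$ is such that $\|P_{k_n}(f_0)-f_0\|_1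 = O(\xi_n)$. Then there exists a constant $M<\infty$ such that $$\Pi_n\left(f\in\mathcal{P} : \|f-f_0\|_1\ge M\xi_n \mid Y\right)\to 0$$ as $n\to\infty$ in $\mathbb{P}_{f_0}$-probability.
   Context: $\mathbb{H}_1,\mathbb{H}_2$ are separable Hilbert spaces with inner products $\langle\cdot,\cdot\rangle_i$ and norms $\|\cdot\|_i$, $i=1,2$. $A:\mathbb{H}_1\to\mathbb{H}_2$ is a known, injective, continuous linear operator with adjoint $A^*$. It is assumed throughout that there is an orthonormal basis $\{e_k\}_{k\ge 1}$ of $\mathbb{H}_1$ consisting of eigenvectors of $A^*A$, with $A^*Ae_k=\rho_k^2 e_k$ ($A$ need not be compact), and $\{g_k\}$ is the conjugate orthonormal system in $\mathbb{H}_2$ (an orthonormal basis of the range of $A$) defined by $Ae_k=\rho_k g_k$. Write $f_k=\langle f,e_k\rangle_1$. Model: for each $n\ge1$ one observes $Y=Y^{(n)}=Af+n^{-1/2}Z$, where $Z$ is Gaussian white noise on $\mathbb{H}_2$, interpreted as the Gaussian process $Y=(Y_h:h\in\mathbb{H}_2)$, $Y_h=\langle Af,h\rangle_2+n^{-1/2}Z_h$, where $(Z_h:h\in\mathbb{H}_2)$ is a mean-zero Gaussian process with $\mathbb{E}Z_hZ_{h'}=\langle h,h'\rangle_2$. Its law is denoted $\mathbb{P}_f$. Equivalently, one observes the independent variables $Y_k:=Y_{g_k}\sim N(\rho_kf_k,n^{-1})$, $k\ge1$. Posterior: for a prior $\Pi$ (a probability measure on a $\sigma$-algebra $\mathcal{B}$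 of $\mathcal{P}\subset\mathbb{H}_1$), the posterior distribution is (written for real scalars) $$\Pi(B\mid Y)=\frac{\int_B e^{n\sum_k\rho_kf_kY_k-\frac n2\|Af\|_2^2}\,d\Pi(f)}{\int_{\mathcal{P}} e^{n\sum_k\rho_kf_kY_k-\frac n2\|Af\|_2^2}\,d\Pi(f)},\qquad B\in\mathcal{B}.$$ For the prior $\Pi_n$ at sample size $n$, $\Pi_n(\cdot\mid Y)$ denotes this posterior with $\Pi=\Pi_n$. *)

(* Defs.v *)
From HB Require Import structures.
From mathcomp Require Import all_boot all_order all_algebra.
From mathcomp Require Import all_classical all_reals all_analysis.
Import Order.TTheory GRing.Theory Num.Theory numFieldNormedType.Exports.

Set Implicit Arguments.
Unset Strict Implicit.
Unset Printing Implicit Defensive.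

Local Open Scope classical_set_scope.
Local Open Scope ring_scope.

(* Throughout, scalars are real, and indices k >= 1 of the mathematical text
   are shifted to k : nat starting at 0. Sample sizes n are not shifted. *)

Definition separable_space (T : topologicalType) : Prop :=
  exists2 D : set T, countable D & dense D.

(* A real separable Hilbert space: completeness is part of the type H, and the
   norm is the one induced by the inner product ip. *)
Definition separable_hilbert (R : realType) (H : completeNormedModType R)
    (ip : {dot H for idfun}) : Prop :=
  (forall x : H, `|x| = Num.sqrt (ip x x)) /\ separable_space H.

Definition lin_span (R : realType) (H : lmodType R) (u : nat -> H) (m : nat) :
    set H :=
  [set v | exists a : 'I_m -> R, v = \sum_(i < m) a i *: u i].

Definition orthonormal_basis (R : realType) (H : completeNormedModType R)
    (ip : {dot H for idfun}) (u : nat -> H) : Prop :=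
  (forall i j, ip (u i) (u j) = (i == j)%:R) /\
  dense (\bigcup_m lin_span u m).

Definition is_orthogonal_projection (R : realType) (H : lmodType R)
    (ip : {dot H for idfun}) (V : set H) (Q : H -> H) : Prop :=
  forall f, V (Q f) /\ forall v, V v -> ip (f - Q f) v = 0.

Definition is_adjoint (R : realType) (H1 H2 : lmodType R)
    (ip1 : {dot H1 for idfun}) (ip2 : {dot H2 for idfun})
    (A : H1 -> H2) (Astar : H2 -> H1) : Prop :=
  forall f h, ip2 (A f) h = ip1 f (Astar h).

Definition active_indices (R : realType) (H : lmodType R)
    (ip : {dot H for idfun}) (phi e : nat -> H) (k : nat) : set nat :=
  [set l | exists m : nat, (m < k)%N /\ `|ip (phi m) (e l)| != 0].

Definition delta_inf (R : realType) (H : lmodType R)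
    (ip : {dot H for idfun}) (phi e : nat -> H) (rho : nat -> R) (k : nat) : R :=
  inf [set `|rho i| | i in active_indices ip phi e k].

(* Normal law of mean m and standard deviation s; s = 0 is treated apart since
   [normal_prob m 0] is not the Dirac mass at m. *)
Definition is_gaussian d (T : measurableType d) (R : realType)
    (P : probability T R) (X : T -> R) : Prop :=
  exists m s : R, 0 <= s /\
    forall B : set R, measurable B ->
      P (X @^-1` B) = if s == 0 then \d_m B else normal_prob m s B.

(* All finite-dimensional marginals are (possibly degenerate) multivariate
   normal, i.e. all finite linear combinations are normal. *)
Definition gaussian_process d (T : measurableType d) (R : realType)
    (P : probability T R) (I : Type) (Z : I -> {RV P >-> R}) : Prop :=
  forall (m : nat) (h : 'I_m -> I) (a : 'I_m -> R),
    is_gaussian P (fun w => \sum_(i < m) a i * Z (h i) w).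

Definition white_noise d (T : measurableType d) (R : realType)
    (P : probability T R) (H : lmodType R) (ip : {dot H for idfun})
    (Z : H -> {RV P >-> R}) : Prop :=
  [/\ gaussian_process Z,
      forall h, ('E_P[Z h] = 0)%E &
      forall h h', ('E_P[fun w => (Z h w * Z h' w)%R] = (ip h h')%:E)%E].

(* Under P, the process Y has the law P_f at sample size n. *)
Definition has_law d (T : measurableType d) (R : realType)
    (P : probability T R) (H1 H2 : lmodType R) (ip2 : {dot H2 for idfun})
    (A : H1 -> H2) (f : H1) (n : nat) (Y : H2 -> {RV P >-> R}) : Prop :=
  exists Z : H2 -> {RV P >-> R}, white_noise ip2 Z /\
    forall h w, Y h w = ip2 (A f) h + (Num.sqrt n%:R)^-1 * Z h w.

(* exp (n sum_k rho_k f_k y_k - n/2 |A f|^2) for y_k = y (g k). The series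
   converges almost surely under P_{f0} for each f, and [limn] returns a
   default value elsewhere. *)
Definition likelihood (R : realType) (H1 H2 : completeNormedModType R)
    (ip1 : {dot H1 for idfun}) (A : H1 -> H2) (e : nat -> H1) (g : nat -> H2)
    (rho : nat -> R) (n : nat) (y : H2 -> R) (f : H1) : R :=
  expR (n%:R * limn (series (fun k => rho k * ip1 f (e k) * y (g k)))
        - n%:R / 2 * `|A f| ^+ 2).

(* A prior on a sigma-algebra B of subsets of Pc is encoded as a probability
   on the sigma-algebra of H1 generated by B, giving mass 1 to Pc. *)
Definition posterior (R : realType) (H1 H2 : completeNormedModType R)
    (ip1 : {dot H1 for idfun}) (A : H1 -> H2) (e : nat -> H1) (g : nat -> H2)
    (rho : nat -> R) (Pc : set H1) (B : set (set H1))
    (Pi : probability (g_sigma_algebraType B) R)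
    (n : nat) (y : H2 -> R) (S : set H1) : R :=
  (\int[Pi]_(f in S) likelihood ip1 A e g rho n y f) /
  (\int[Pi]_(f in Pc) likelihood ip1 A e g rho n y f).

(* The probability spaces may vary with n. *)
Definition cvg_in_probability (R : realType) (d : nat -> measure_display)
    (T : forall n, measurableType (d n)) (P : forall n, probability (T n) R)
    (X : forall n, T n -> R) (l : R) : Prop :=
  forall eta : R, 0 < eta ->
    P n [set w | eta <= `|X n w - l|] @[n --> \oo] --> 0%E.

(* Main.v *)
Require Import Defs.
From HB Require Import structures.
From mathcomp Require Import all_boot all_order all_algebra.
From mathcomp Require Import all_classical all_reals all_analysis.
From mathcomp Require Import measurable_realfun.
From mathcomp Require Import ring lra.
Import Order.TTheory GRing.Theory Num.Theory numFieldNormedType.Exports.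

Set Implicit Arguments.
Unset Strict Implicit.
Unset Printing Implicit Defensive.

Local Open Scope classical_set_scope.
Local Open Scope ring_scope.

(** The posterior contracts because two likelihood bounds compete on the scale
    [r = n eps^2], which tends to infinity, and the prior conditions decide the
    competition.  Everything is read off the noise coordinates [z_k = Z (g k)],
    of which a single property is used ([white_noise_subgaussian]): the
    expectation of [exp (sum_k b_k z_k)] is at most [exp (|b|^2 / 2)], first for
    finite sums and then, in the limit, for square-summable b.

    For a fixed f, the logarithm of the likelihood ratio of f against f0 is
    almost surely [sum_k b_k z_k - V / 2], where
    [b_k = sqrt n * rho_k * (f - f0)_k] is square-summable with sum
    [V = n |A (f - f0)|^2] ([log_likelihood_ratio_ae]).  The almost
    sure convergence of this series follows from a maximal inequality for partial
    sums with controlled fourth moments of increments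
    ([maximal_fourth_moment], [subgaussian_series_cvg]).  By Fatou's lemma
    the likelihood ratio then has expectation at most 1, and its inverse has
    expectation at most [exp V].

    The denominator of the posterior.  On the ball [|A f - A f0| <= eps] we have
    [V <= r], so that the integral of the inverse ratio over the ball is below
    [exp (2 r)] times the prior mass of the ball, outside an event of
    probability [exp (- r)].  There, by the inequality
    [x >= 2 lam - lam^2 / x] with [lam = exp (- 2 r)], the evidence is at least
    [exp (- 2 r)] times the prior mass of the ball, hence at least
    [exp (- (C + 2) r)].

    The numerator of the posterior.  Invert A on the data and project on the
    span of the first k = kn vectors phi; since these vectors involve finitely
    many e_l, all of them with [|rho_l| >= delta], the noise is amplified by at
    most [1 / delta] ([test_vectors_contract]).  The test statistic is half the
    squared distance of this estimator of f0 from the projection of f0, in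
    units of the noise.  Exponential moments of squares of sub-Gaussian
    variables cost a factor [sqrt 2] per coordinate, in all at most
    [exp k <= exp (c r)], under f0 and, by a change of measure, under every f
    ([tilted_expR_square_le]).  If f is in the sieve and
    [|f - f0| >= M xi], then the projections of f and f0 are at least
    [(M - C2 - C3) xi] apart, and [eps <= C1 xi delta] turns this into
    a signal of order [M^2 r].  For M large the test separates f0 from f with
    error [exp (- r)] under f0 and [exp (- (C + 4) r)] under f.  The set
    outside the sieve has prior mass [exp (- (C + 4) r)] by assumption.

    By Fubini's theorem the numerator, where the test accepts f0, has
    expectation at most [2 exp (- (C + 4) r)], which is negligible with respect
    to the lower bound [exp (- (C + 2) r)] of the evidence ([posterior_tail]).
    This yields a bound for each n, with an explicit M
    ([posterior_deviation]). *)

(** * Gaussian integrals *)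

Section gaussian_integrals.
Context {R : realType}.
Notation mu := (@lebesgue_measure R).
Implicit Types (m s q t : R).

(** The Radon-Nikodym derivative is determined by the integrals over measurable
    sets, hence is almost everywhere the normal density. *)
Lemma ge0_integral_normal_prob m s (f : R -> \bar R) :
  measurable_fun [set: R] f -> (forall x, 0 <= f x)%E ->
  (\int[normal_prob m s]_x f x = \int[mu]_x (f x * (normal_pdf m s x)%:E))%E.
Proof.
move=> mf f0.
rewrite -(Radon_Nikodym_SigmaFinite.change_of_variables
  (normal_prob_dominates m s))//.
have dens_int := Radon_Nikodym_SigmaFinite.f_integrable
  (normal_prob_dominates m s).
apply: ae_eq_integral => //.
- by apply: emeasurable_funM => //; exact: (measurable_int mu).
- apply: emeasurable_funM => //; apply/measurable_EFinP.
  exact: measurable_normal_pdf.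
- apply: ae_eqe_mul2l; apply: integral_ae_eq => //.
    by apply/measurable_EFinP; exact: measurable_normal_pdf.
  move=> E _ mE; rewrite -Radon_Nikodym_SigmaFinite.f_integral//.
  exact: normal_prob_dominates.
Qed.

(** Completing the square turns the integrand into a constant multiple of the
    density with mean [m + s^2 t]. *)
Lemma normal_mgf m s t : s != 0 ->
  (\int[normal_prob m s]_x (expR (t * x))%:E =
   (expR (t * m + s ^+ 2 * t ^+ 2 / 2))%:E)%E.
Proof.
move=> s0; rewrite ge0_integral_normal_prob//; last first.
  by apply/measurable_EFinP; apply: measurableT_comp => //; exact: mulrl_measurable.
transitivity (\int[mu]_x ((expR (t * m + s ^+ 2 * t ^+ 2 / 2))%:E *
    (normal_pdf (m + s ^+ 2 * t) s x)%:E))%E.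
  apply: eq_integral => x _; rewrite -!EFinM !normal_pdfE//; congr EFin.
  rewrite mulrCA [RHS]mulrCA; congr *%R; rewrite /normal_fun -!expRD.
  congr expR; field.
  exact: s0.
rewrite ge0_integralZl//.
- by rewrite integral_normal_pdf mule1.
- by apply/measurable_EFinP; exact: measurable_normal_pdf.
- by move=> x _; rewrite lee_fin normal_pdf_ge0.
Qed.

(** The integrand is a constant multiple of the centered normal density with
    variance [s^2 / (1 - 2 q s^2)]. *)
Lemma normal_exp_square s q : s != 0 -> 0 < 1 - 2 * q * s ^+ 2 ->
  (\int[normal_prob 0 s]_x (expR (q * x ^+ 2))%:E =
   ((Num.sqrt (1 - 2 * q * s ^+ 2))^-1)%:E)%E.
Proof.
move=> s0; set k := 1 - _ => k0.
have r0 : 0 < Num.sqrt k by rewrite sqrtr_gt0.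
have r2 : Num.sqrt k ^+ 2 = k by rewrite sqr_sqrtr// ltW.
have s'0 : s / Num.sqrt k != 0 by apply: mulf_neq0 => //; rewrite invr_eq0 gt_eqF.
rewrite ge0_integral_normal_prob//; last first.
  apply/measurable_EFinP; apply: measurableT_comp => //.
  by apply: measurable_funM => //; exact: exprn_measurable.
transitivity (\int[mu]_x ((Num.sqrt k)^-1%:E *
    (normal_pdf 0 (s / Num.sqrt k) x)%:E))%E.
  apply: eq_integral => x _; rewrite -!EFinM !normal_pdfE//; congr EFin.
  rewrite mulrCA [RHS]mulrA; congr (_ * _).
    rewrite /normal_peak expr_div_n r2.
    rewrite -[X in _ = X^-1 * _](ger0_norm (ltW r0)) -sqrtr_sqr r2.
    rewrite -invfM -sqrtrM ?(ltW k0)//.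
    congr (_^-1); congr Num.sqrt.
    rewrite -mulrnAr -[in RHS]mulrnAr; field.
    by rewrite gt_eqF.
  rewrite /normal_fun -expRD; congr expR; rewrite expr_div_n r2 !subr0.
  rewrite /k; field; rewrite s0 /=; move: k0; rewrite /k => k0.
  by rewrite gt_eqF.
rewrite ge0_integralZl//.
- by rewrite integral_normal_pdf mule1.
- by apply/measurable_EFinP; exact: measurable_normal_pdf.
- by move=> x _; rewrite lee_fin normal_pdf_ge0.
Qed.

End gaussian_integrals.

Section gaussian_variable.
Context d (T : measurableType d) (R : realType) (P : probability T R).
Variable X : T -> R.
Hypothesis mX : measurable_fun [set: T] X.

Lemma ge0_integral_law (nu : {measure set (measurableTypeR R) -> \bar R})
    (f : R -> \bar R) :
  (forall B : set R, measurable B -> P (X @^-1` B) = nu B) ->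
  measurable_fun [set: R] f -> (forall x, 0 <= f x)%E ->
  (\int[P]_w f (X w) = \int[nu]_x f x)%E.
Proof.
move=> PX mf f0.
(* The law of X is compared with nu on the copy of R that carries nu; both
   copies of R have the same measurable sets. *)
pose X' : T -> measurableTypeR R := X.
have mX' : measurable_fun [set: T] X' by exact: mX.
rewrite -[LHS](@ge0_integral_pushforward _ _ _ _ _ _ mX' P setT f)//.
by apply: eq_measure_integral => B mB _; exact: PX.
Qed.

Lemma gaussian_mgf (m s t : R) :
  (forall B : set R, measurable B ->
     P (X @^-1` B) = if s == 0 then \d_m B else normal_prob m s B) ->
  (\int[P]_w (expR (t * X w))%:E =
   (expR (t * m + s ^+ 2 * t ^+ 2 / 2))%:E)%E.
Proof.
have mt : measurable_fun [set: R] (fun x : R => (expR (t * x))%:E).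
  by apply/measurable_EFinP; apply: measurableT_comp.
have [->|s0] := eqVneq s 0 => PX.
- apply: etrans (ge0_integral_law (nu := \d_(m : measurableTypeR R)) PX mt _) _.
    by move=> x; rewrite lee_fin expR_ge0.
  by rewrite integral_dirac// diracT mul1e expr0n/= !mul0r addr0.
- apply: etrans (ge0_integral_law (nu := normal_prob m s) PX mt _) _.
    by move=> x; rewrite lee_fin expR_ge0.
  exact: normal_mgf.
Qed.

Lemma integrable_square (v : R) :
  (\int[P]_w (X w * X w)%:E = v%:E)%E ->
  P.-integrable setT (fun w => (X w * X w)%:E).
Proof.
move=> X2; apply/integrableP; split.
  by apply/measurable_EFinP; exact: measurable_funM.
rewrite (eq_integral (fun w => (X w * X w)%:E)) ?X2 ?ltry// => w _.
by rewrite gee0_abs// lee_fin -expr2 sqr_ge0.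
Qed.

Lemma integrable_of_square (v : R) :
  (\int[P]_w (X w * X w)%:E = v%:E)%E -> P.-integrable setT (EFin \o X).
Proof.
move=> X2; have iX2 := integrable_square X2.
have i1 : P.-integrable setT (fun w : T => (1 : R)%:E).
  exact: finite_measure_integrable_cst.
apply: (le_integrable _ _ _ (integrableD measurableT i1 iX2)) => //.
  exact/measurable_EFinP.
move=> w _ /=; rewrite lee_fin [leRHS]ger0_norm; last first.
  by rewrite addr_ge0// -expr2 sqr_ge0.
rewrite -expr2 -real_normK ?num_real//.
have : 0 <= `|X w| by [].
by move: `|X w| => x x0; nra.
Qed.

(** This is Jensen's inequality in the weaker form that follows at once from
    [expR y >= 1 + y]. *)
Lemma integral_expR_ge1D (Y : T -> R) (a : R) :
  P.-integrable setT (EFin \o Y) -> (\int[P]_w (Y w)%:E = a%:E)%E ->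
  ((1 + a)%:E <= \int[P]_w (expR (Y w))%:E)%E.
Proof.
move=> iY EY.
have mY : measurable_fun [set: T] Y by exact/measurable_EFinP/(measurable_int P).
have mE : measurable_fun [set: T] (fun w => (expR (Y w))%:E).
  by apply/measurable_EFinP; exact: measurableT_comp.
have i1 : P.-integrable setT (fun w : T => (1 : R)%:E).
  exact: finite_measure_integrable_cst.
have [->|/eqP Efin] := eqVneq (\int[P]_w (expR (Y w))%:E)%E +oo%E.
  exact: leey.
have -> : (1 + a)%:E = (\int[P]_w (1%:E + (Y w)%:E))%E :> \bar R.
  by rewrite integralD//= EY integral_cst//= probability_setT mule1.
apply: le_integral => //.
- exact: integrableD.
- apply/integrableP; split => //.
  under eq_integral do rewrite gee0_abs ?lee_fin ?expR_ge0//.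
  by rewrite ltey; apply/eqP.
- by move=> w _; rewrite -EFinD lee_fin expR_ge1Dx.
Qed.

(** The parameters m and s of the law of X are recovered from the first two
    moments of X by means of exponential moments: the moment generating function
    of a centered variable is at least 1, which forces m = 0, and
    [E exp (- th X^2) >= 1 - th v] for small th forces [s^2 <= v]. *)
Lemma centered_gaussian_expR_le (v : R) :
  is_gaussian P X -> (\int[P]_w (X w)%:E = 0)%E ->
  (\int[P]_w (X w * X w)%:E = v%:E)%E ->
  (\int[P]_w (expR (X w))%:E <= (expR (v / 2))%:E)%E.
Proof.
move=> [m [s [s0 PX]]] EX EX2.
have mgf t := gaussian_mgf t PX.
have iX := integrable_of_square EX2.
(* Since tX is centered, its exponential has expectation at least 1. *)
have mgf_ge1 t : 0 <= t * m + s ^+ 2 * t ^+ 2 / 2.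
  rewrite -ler_expR expR0 -lee_fin -mgf -[leLHS]addr0.
  apply: (integral_expR_ge1D (a := 0)).
    have itX : P.-integrable setT (fun w => t%:E * (X w)%:E)%E.
      exact: integrableZl.
    exact: itX.
  under eq_integral do rewrite EFinM.
  by rewrite integralZl//= EX mule0.
have m0 : m = 0.
  (* The minimizer t = - m / s^2 is unavailable when s = 0; with s^2 + 1
     instead of s^2 the quadratic function is still negative unless m = 0. *)
  have := mgf_ge1 (- m / (s ^+ 2 + 1)).
  have s2 : 0 <= s ^+ 2 by exact: sqr_ge0.
  move: (s ^+ 2) s2 => u u0.
  have -> : - m / (u + 1) * m + u * (- m / (u + 1)) ^+ 2 / 2 =
    - (m ^+ 2 * (u + 2) / (2 * (u + 1) ^+ 2)).
    by field; rewrite gt_eqF// ltr_wpDl.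
  rewrite oppr_ge0 => h.
  have [//|mn0] := eqVneq m 0.
  suff : 0 < m ^+ 2 * (u + 2) / (2 * (u + 1) ^+ 2) by rewrite ltNge h.
  apply: divr_gt0; apply: mulr_gt0 => //.
  - by rewrite exprn_even_gt0.
  - by rewrite ltr_wpDl.
  - by rewrite exprn_gt0// ltr_wpDl.
have v0 : 0 <= v.
  rewrite -lee_fin -EX2; apply: integral_ge0 => w _.
  by rewrite lee_fin -expr2 sqr_ge0.
suff s2v : s ^+ 2 <= v.
  have := mgf 1; under eq_integral do rewrite mul1r.
  move=> ->; rewrite lee_fin ler_expR m0 mulr0 add0r expr1n mulr1.
  by rewrite ler_pM2r ?invr_gt0.
have [->|sn0] := eqVneq s 0; first by rewrite expr0n.
have s2 : 0 < s ^+ 2 by rewrite exprn_even_gt0.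
rewrite leNgt; apply/negP => vs.
(* The function E exp (- th X^2) is (1 + 2 th s^2)^(-1/2) and at least
   1 - th v; for small th > 0 this is contradictory if v < s^2, and the chosen
   th is small enough. *)
pose th := (s ^+ 2 - v) / (4 * v * s ^+ 2 + 1).
have den0 : 0 < 4 * v * s ^+ 2 + 1 by rewrite ltr_wpDl// !mulr_ge0// ltW.
have th0 : 0 < th by rewrite divr_gt0// subr_gt0.
have thE : th * (4 * v * s ^+ 2 + 1) = s ^+ 2 - v by rewrite /th divfK// gt_eqF.
clearbody th.
have k0 : 0 < 1 - 2 * (- th) * s ^+ 2.
  have u0 : 0 < 2 * th * s ^+ 2 by apply: mulr_gt0 => //; apply: mulr_gt0.
  by rewrite mulrN mulNr opprK addr_gt0.
have Ens := normal_exp_square sn0 k0.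
have msq : measurable_fun [set: R] (fun x : R => (expR (- th * x ^+ 2))%:E).
  apply/measurable_EFinP; apply: measurableT_comp => //.
  by apply: measurable_funM => //; exact: exprn_measurable.
have PX0 B : measurable B -> P (X @^-1` B) = normal_prob 0 s B.
  by move=> /PX ->; rewrite (negbTE sn0) m0.
have Eq : (\int[P]_w (expR (- th * X w ^+ 2))%:E =
  ((Num.sqrt (1 - 2 * - th * s ^+ 2))^-1)%:E)%E.
  rewrite -Ens; apply: (ge0_integral_law (nu := normal_prob 0 s) PX0 msq).
  by move=> x; rewrite lee_fin expR_ge0.
have := @integral_expR_ge1D (fun w => - th * X w ^+ 2) (- (th * v)).
rewrite Eq lee_fin => h.
have {}h : 1 - th * v <= (Num.sqrt (1 - 2 * - th * s ^+ 2))^-1.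
  apply: h.
    have itX : P.-integrable setT (fun w => (- th)%:E * (X w * X w)%:E)%E.
      by apply: integrableZl => //; exact: integrable_square EX2.
    exact: itX.
  under eq_integral do rewrite expr2 EFinM.
  rewrite integralZl//=; last exact: integrable_square EX2.
  by rewrite EX2 -EFinM mulNr.
have k' : 0 < Num.sqrt (1 - 2 * - th * s ^+ 2) by rewrite sqrtr_gt0.
move: h; rewrite -[leRHS]mul1r ler_pdivlMr// => h.
have thv : 0 <= 1 - th * v by rewrite subr_ge0; nra.
have : ((1 - th * v) * Num.sqrt (1 - 2 * - th * s ^+ 2)) ^+ 2 <= 1.
  by rewrite expr_le1// mulr_ge0// ltW.
rewrite exprMn sqr_sqrtr ?(ltW k0)// => hle.
have : (1 - th * v) ^+ 2 * (1 - 2 * - th * s ^+ 2) <= 1 by exact: hle.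
have -> : (1 - th * v) ^+ 2 * (1 - 2 * - th * s ^+ 2) =
  1 + 2 * th * (s ^+ 2 - v) + th ^+ 2 * v ^+ 2 - 4 * th ^+ 2 * v * s ^+ 2
    + 2 * th ^+ 3 * v ^+ 2 * s ^+ 2 by ring.
rewrite -thE.
have -> : 1 + 2 * th * (th * (4 * v * s ^+ 2 + 1)) + th ^+ 2 * v ^+ 2
    - 4 * th ^+ 2 * v * s ^+ 2 + 2 * th ^+ 3 * v ^+ 2 * s ^+ 2 =
  1 + th ^+ 2 * (v ^+ 2 + 4 * v * s ^+ 2 + 2 + 2 * th * v ^+ 2 * s ^+ 2) by ring.
rewrite gerDl leNgt mulr_gt0// ?exprn_gt0//.
rewrite ltr_wpDr// ?ltr_wpDl// ?addr_ge0// ?sqr_ge0// !mulr_ge0 ?sqr_ge0//.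
exact: ltW.
Qed.

End gaussian_variable.

(** * Sub-Gaussian sequences *)

(** This is the joint control that independent standard normal variables satisfy
    with equality; every bound on the noise below is derived from it. *)
Definition subgaussian d (T : measurableType d) (R : realType)
    (P : probability T R) (xi : nat -> T -> R) : Prop :=
  (forall k, measurable_fun [set: T] (xi k)) /\
  forall (b : nat -> R) n,
    (\int[P]_w (expR (\sum_(0 <= k < n) b k * xi k w))%:E <=
     (expR ((\sum_(0 <= k < n) b k ^+ 2) / 2))%:E)%E.

Section white_noise_subgaussian.
Context d (T : measurableType d) (R : realType) (P : probability T R).

(** A linear combination of the [Z (g k)] is Gaussian and centered, and its
    variance is the sum of the [b_k^2] because g is orthonormal. *)
Lemma white_noise_subgaussian (H : lmodType R) (ip : {dot H for idfun})
    (Z : H -> {RV P >-> R}) (g : nat -> H) :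
  white_noise ip Z -> (forall i j, ip (g i) (g j) = (i == j)%:R) ->
  subgaussian P (fun k => Z (g k)).
Proof.
move=> [GZ EZ covZ] orth; split => [k|b n]; first exact: measurable_funPT.
pose xi k : T -> R := Z (g k).
have mxi k : measurable_fun [set: T] (xi k) by exact: measurable_funPT.
have Exi k : (\int[P]_w (xi k w)%:E = 0)%E by have := EZ (g k); rewrite unlock.
have Exixj i j : (\int[P]_w (xi i w * xi j w)%:E = ((i == j)%:R : R)%:E)%E.
  by have := covZ (g i) (g j); rewrite unlock orth.
have ixi2 k : P.-integrable setT (fun w => (xi k w * xi k w)%:E).
  exact: (integrable_square (mxi k) (Exixj k k)).
have ixi k : P.-integrable setT (fun w => (xi k w)%:E).
  exact: (integrable_of_square (mxi k) (Exixj k k)).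
have ixixj i j : P.-integrable setT (fun w => (xi i w * xi j w)%:E).
  apply: (le_integrable _ _ _ (integrableD measurableT (ixi2 i) (ixi2 j))) => //.
    by apply/measurable_EFinP; exact: measurable_funM.
  move=> w _ /=; rewrite lee_fin [leRHS]ger0_norm; last first.
    by rewrite addr_ge0// -expr2 sqr_ge0.
  rewrite normrM -!expr2 -real_normK ?num_real//.
  rewrite -[X in _ <= _ + X]real_normK ?num_real//.
  move: (normr_ge0 (xi i w)) (normr_ge0 (xi j w)).
  by move: `|xi i w| `|xi j w| => x y x0 y0; nra.
under eq_integral do rewrite big_mkord.
rewrite big_mkord; apply: centered_gaussian_expR_le.
- by apply: measurable_sum => i; exact: measurable_funM.
- exact: (GZ n (fun i => g i) (fun i => b i)).
- rewrite (eq_integral (fun w => \sum_(i < n) ((b i)%:E * (xi i w)%:E))%E); last first.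
    by move=> w _; rewrite -sumEFin; apply: eq_bigr => i _; rewrite EFinM.
  rewrite integral_sum//; last by move=> i; exact: integrableZl.
  by apply: big1 => i _; rewrite integralZl//= Exi mule0.
- rewrite (eq_integral (fun w => \sum_(i < n) \sum_(j < n)
      ((b i * b j)%:E * (xi i w * xi j w)%:E))%E); last first.
    move=> w _; rewrite big_distrl/= -sumEFin; apply: eq_bigr => i _.
    rewrite big_distrr/= -sumEFin; apply: eq_bigr => j _.
    by rewrite -EFinM mulrACA.
  rewrite integral_sum//; last first.
    move=> i; apply: integrable_sum => // j _.
    exact: integrableZl.
  rewrite -sumEFin; apply: eq_bigr => i _.
  rewrite integral_sum//; last by move=> j; exact: integrableZl.
  rewrite (bigD1 i)//= big1 ?adde0.
    by rewrite integralZl//= Exixj eqxx mule1 expr2.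
  move=> j ji; rewrite integralZl//= Exixj.
  by rewrite val_eqE eq_sym (negbTE ji) mule0.
Qed.

End white_noise_subgaussian.

(** * A maximal inequality from fourth moments *)

Section maximal_inequality.
Context d (T : measurableType d) (R : realType) (P : probability T R).

(** From [y <= expR y] for [y = |x| / 4]. *)
Lemma pow4_le_expR (x : R) : x ^+ 4 <= 4 ^+ 4 * (expR x + expR (- x)).
Proof.
have h : `|x| ^+ 4 <= 4 ^+ 4 * expR `|x|.
  have -> : expR `|x| = expR (`|x| / 4) ^+ 4.
    by rewrite -expRM_natl mulrC divfK.
  have h1 : 0 <= `|x| / 4 by rewrite divr_ge0.
  have h2 : `|x| / 4 <= expR (`|x| / 4).
    by apply: le_trans (expR_ge1Dx _); rewrite lerDr.
  have : (`|x| / 4) ^+ 4 <= expR (`|x| / 4) ^+ 4.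
    by rewrite lerXn2r// nnegrE ?expR_ge0.
  by rewrite expr_div_n ler_pdivrMr ?exprn_gt0// mulrC.
have -> : x ^+ 4 = `|x| ^+ 4 by rewrite -normrX ger0_norm// exprn_even_ge0.
apply: (le_trans h); rewrite ler_pM2l ?exprn_gt0//.
by case: (ger0P x) => _; rewrite ?lerDl ?lerDr expR_ge0.
Qed.

Lemma ge0_integral_lincomb (mu : {measure set T -> \bar R}) (a b : R)
    (f g : T -> R) :
  0 <= a -> 0 <= b ->
  measurable_fun [set: T] f -> measurable_fun [set: T] g ->
  (forall w, 0 <= f w) -> (forall w, 0 <= g w) ->
  (\int[mu]_w (a * f w + b * g w)%:E =
   a%:E * \int[mu]_w (f w)%:E + b%:E * \int[mu]_w (g w)%:E)%E.
Proof.
move=> a0 b0 mf mg f0 g0.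
under eq_integral do rewrite EFinD.
rewrite ge0_integralD//.
- under eq_integral do rewrite EFinM.
  rewrite ge0_integralZl_EFin//; first by
    under [X in (_ + X)%E]eq_integral do rewrite EFinM;
    rewrite ge0_integralZl_EFin//; [move=> w _; rewrite lee_fin|exact/measurable_EFinP].
  + by move=> w _; rewrite lee_fin.
  + exact/measurable_EFinP.
- by move=> w _; rewrite lee_fin mulr_ge0.
- by apply/measurable_EFinP; exact: measurable_funM.
- by move=> w _; rewrite lee_fin mulr_ge0.
- by apply/measurable_EFinP; exact: measurable_funM.
Qed.

(** The variable G plays the role of the maximum of the fourth powers of the
    increments.  It is built by bisection: m is the first index by which U has made
    half of its increase over [i, i + n], so that U increases by at most half on
    each side of m.  An increment that ends before m is controlled by the left half;
    a later one is split at m.  The two halves together return at most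
    [125/64 * 2 * (1/2)^2 = 125/128] of K, and since this is less than 1 the
    recursion closes with a constant K that depends on C only. *)
Lemma maximal_fourth_moment (S : nat -> T -> R) (U : nat -> R) (C K : R) :
  0 <= C -> 125 * C + 125 / 128 * K <= K -> (forall i, measurable_fun [set: T] (S i)) ->
  {homo U : i j / (i <= j)%N >-> i <= j} ->
  (forall i j, (i <= j)%N ->
    (\int[P]_w ((S j w - S i w) ^+ 4)%:E <= (C * (U j - U i) ^+ 2)%:E)%E) ->
  forall n i, exists G : T -> R, [/\ measurable_fun [set: T] G,
    (forall w, 0 <= G w),
    (forall k w, (k <= n)%N -> (S (i + k)%N w - S i w) ^+ 4 <= G w) &
    (\int[P]_w (G w)%:E <= (K * (U (i + n)%N - U i) ^+ 2)%:E)%E].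
Proof.
move=> C0 hK mS ndU incr n; have K0 : 0 <= K by lra.
elim/ltn_ind: n => n IH i.
have [->|n0] := posnP n.
  exists (fun=> 0); split => //.
  - by move=> k w; rewrite leqn0 => /eqP ->; rewrite addn0 subrr expr0n.
  - by rewrite integral0 lee_fin mulr_ge0// sqr_ge0.
set u := U (i + n)%N - U i.
have u0 : 0 <= u by rewrite subr_ge0 ndU// leq_addr.
(* Q m: at least half of the increase of U has occurred by i + m. *)
pose Q m := [&& (0 < m)%N, (m <= n)%N & u <= 2 * (U (i + m)%N - U i)].
have exQ : exists m, Q m.
  by exists n; rewrite /Q n0 leqnn/= -/u; lra.
case: (ex_minnP exQ) => m /and3P[m0 mn um] minm.
have [|G1 [mG1 G10 G1S EG1]] := IH m.-1 _ i; first by rewrite prednK.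
have [|G2 [mG2 G20 G2S EG2]] := IH (n - m)%N _ (i + m)%N.
  by rewrite ltn_subrL m0.
rewrite -addnA subnKC// in EG2.
have Um : U i <= U (i + m)%N by rewrite ndU// leq_addr.
have Um' : U (i + m)%N <= U (i + n)%N by rewrite ndU// leq_add2l.
have u1 : 0 <= U (i + m.-1)%N - U i <= u / 2.
  rewrite subr_ge0 ndU ?leq_addr//=.
  have [->|m1] := posnP m.-1; first by rewrite addn0 subrr; lra.
  have : ~~ Q m.-1 by apply/negP => /minm; rewrite leqNgt prednK// leqnn.
  rewrite /Q m1 (leq_trans (leq_pred m) mn)/= -ltNge; lra.
have u2 : 0 <= U (i + n)%N - U (i + m)%N <= u / 2.
  by apply/andP; split; move: um; rewrite /u; lra.
pose G w := 125 * (S (i + m)%N w - S i w) ^+ 4 + 125 / 64 * (G1 w + G2 w).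
(* Convexity of the fourth power with weights 1/5 and 4/5: these make the
   factor of y^4 smaller than 2, which the recursion requires. *)
have sq4 (x y : R) : (x + y) ^+ 4 <= 125 * x ^+ 4 + 125 / 64 * y ^+ 4.
  have sq (a b : R) : (a + b) ^+ 2 <= 5 * a ^+ 2 + 5 / 4 * b ^+ 2.
    by have := sqr_ge0 (2 * a - b / 2); nra.
  have := sq x y; have := sqr_ge0 (x + y).
  have -> : (x + y) ^+ 4 = ((x + y) ^+ 2) ^+ 2 by rewrite -exprM.
  move: ((x + y) ^+ 2) => z z0 zle.
  apply: (@le_trans _ _ ((5 * x ^+ 2 + 5 / 4 * y ^+ 2) ^+ 2)).
    by rewrite ler_pXn2r// nnegrE// addr_ge0// mulr_ge0// sqr_ge0.
  apply: (le_trans (sq _ _)).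
  by rewrite le_eqVlt; apply/orP; left; apply/eqP; field.
have pos4 (x : R) : 0 <= x ^+ 4 by rewrite exprn_even_ge0.
have mSS : measurable_fun [set: T] (fun w => (S (i + m)%N w - S i w) ^+ 4).
  by apply: measurable_funX; exact: measurable_funB.
exists G; split.
- by apply: measurable_funD; apply: measurable_funM => //; exact: measurable_funD.
- by move=> w; rewrite /G addr_ge0// mulr_ge0// addr_ge0.
- move=> k w kn; rewrite /G.
  have [km|mk] := ltnP k m.
    have := G1S k w; rewrite -ltnS prednK// => /(_ km).
    have := G10 w; have := G20 w; have := pos4 (S (i + m)%N w - S i w).
    lra.
  have := G2S (k - m)%N w; rewrite leq_sub2r// => /(_ isT).
  rewrite -addnA subnKC// => hk.
  rewrite -[X in X ^+ 4](subrKA (S (i + m)%N w)) addrC.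
  apply: (le_trans (sq4 _ _)); rewrite lerD2l ler_pM2l//.
  by have := G10 w; lra.
have mG12 : measurable_fun [set: T] (fun w => 1 * G1 w + 1 * G2 w).
  by apply: measurable_funD; exact: measurable_funM.
have -> : (\int[P]_w (G w)%:E = 125%:E * \int[P]_w ((S (i + m)%N w - S i w) ^+ 4)%:E
    + (125 / 64)%:E * (\int[P]_w (G1 w)%:E + \int[P]_w (G2 w)%:E))%E.
  transitivity (\int[P]_w (125 * (S (i + m)%N w - S i w) ^+ 4 +
    125 / 64 * (1 * G1 w + 1 * G2 w))%:E)%E.
    by apply: eq_integral => w _; rewrite /G !mul1r.
  rewrite ge0_integral_lincomb//; last by move=> w; rewrite !mul1r addr_ge0.
  by rewrite ge0_integral_lincomb// !mul1e.
have E0 := incr i (i + m)%N (leq_addr _ _).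
apply: (@le_trans _ _ (125%:E * (C * (U (i + m)%N - U i) ^+ 2)%:E +
  (125 / 64)%:E * ((K * (U (i + m.-1)%N - U i) ^+ 2)%:E +
    (K * (U (i + n)%N - U (i + m)%N) ^+ 2)%:E)))%E.
  apply: leeD; first by rewrite lee_pmul2l.
  by rewrite lee_pmul2l//; apply: leeD.
rewrite -(EFinD (K * _) (K * _)) -(EFinM 125 _) -(EFinM (125 / 64) _).
rewrite -(EFinD (125 * _) _) lee_fin.
have h1 : (U (i + m)%N - U i) ^+ 2 <= u ^+ 2.
  by apply: lerXn2r; rewrite ?nnegrE /u; lra.
have h2 : (U (i + m.-1)%N - U i) ^+ 2 <= (u / 2) ^+ 2.
  by case/andP: u1 => ? ?; rewrite ler_pXn2r ?nnegrE// divr_ge0.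
have h3 : (U (i + n)%N - U (i + m)%N) ^+ 2 <= (u / 2) ^+ 2.
  by case/andP: u2 => ? ?; rewrite ler_pXn2r ?nnegrE// divr_ge0.
rewrite expr_div_n in h2 h3.
move: h1 h2 h3 (sqr_ge0 u).
move: ((U (i + m)%N - U i) ^+ 2) ((U (i + m.-1)%N - U i) ^+ 2)
  ((U (i + n)%N - U (i + m)%N) ^+ 2) (u ^+ 2) => a b e v h1 h2 h3 v0.
apply: (@le_trans _ _ ((125 * C + 125 / 128 * K) * v)); last by rewrite ler_wpM2r.
have : C * a <= C * v by rewrite ler_wpM2l.
have : K * b <= K * (v / 2 ^+ 2) by rewrite ler_wpM2l.
have : K * e <= K * (v / 2 ^+ 2) by rewrite ler_wpM2l.
lra.
Qed.

End maximal_inequality.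

(** * Limits of sub-Gaussian series *)

Section limits_of_measurable_functions.
Context d (T : measurableType d) (R : realType).

(** The Cauchy criterion is written with countable quantifiers so that the set of
    convergence is visibly measurable. *)
Lemma cvgn_cauchy_invS (u : nat -> R) :
  cvgn u <-> forall m, exists N, forall k, `|u (N + k)%N - u N| <= m.+1%:R^-1.
Proof.
split.
- move=> /cvg_cauchy /cauchy_ballP cu m.
  have := cu (m.+1%:R^-1).
  have e0 : 0 < m.+1%:R^-1 :> R by rewrite invr_gt0.
  move=> /(_ e0) [[A B]/= [[N1 _ N1A] [N2 _ N2B]] AB].
  exists (maxn N1 N2) => k.
  have /= := AB (u (maxn N1 N2 + k)%N, u (maxn N1 N2)).
  rewrite /ball/= => h; apply/ltW/h; split => /=.
    by apply: N1A => /=; rewrite (leq_trans (leq_maxl N1 N2))// leq_addr.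
  by apply: N2B => /=; rewrite leq_maxr.
- move=> h; apply: cauchy_cvg; apply: cauchy_exP => e e0.
  have [m me] : exists m, m.+1%:R^-1 < e.
    by have [m] := ltr_add_invr e0; rewrite add0r => h1; exists m.
  have [N hN] := h m.
  exists (u N); exists N => // n /= Nn.
  rewrite /ball/= distrC; apply: le_lt_trans me.
  by have := hN (n - N)%N; rewrite subnKC.
Qed.

Lemma measurable_cvgn (u : nat -> T -> R) :
  (forall n, measurable_fun [set: T] (u n)) ->
  measurable [set w | cvgn (u ^~ w)].
Proof.
move=> mu.
rewrite (_ : [set _ | _] = \bigcap_m \bigcup_N \bigcap_k
    [set w | `|u (N + k)%N w - u N w| <= m.+1%:R^-1]).
  apply: bigcapT_measurable => m; apply: bigcupT_measurable => N.
  apply: bigcapT_measurable => k.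
  have mf : measurable_fun [set: T] (fun w => `|u (N + k)%N w - u N w|).
    exact: (measurableT_comp (@normr_measurable R setT) (measurable_funB (mu _) (mu _))).
  by have := measurable_fun_ler mf (measurable_cst (m.+1%:R^-1 : R));
    move=> /(_ measurableT [set true] Logic.I); rewrite setTI.
apply/seteqP; split => w /=.
- by move=> /cvgn_cauchy_invS h m _; have [N hN] := h m; exists N => // k _; exact: hN.
- move=> h; apply/cvgn_cauchy_invS => m.
  by have [N _ hN] := h m Logic.I; exists N => k; exact: hN.
Qed.

(** Off the measurable set where the sequence converges, [limn] is a constant. *)
Lemma measurable_limn (u : nat -> T -> R) :
  (forall n, measurable_fun [set: T] (u n)) ->
  measurable_fun [set: T] (fun w => limn (u ^~ w)).
Proof.
move=> mu.
pose h n w := if w \in [set w | cvgn (u ^~ w)] then u n w else (point : R).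
apply: (measurable_fun_cvg (h := h)) => [n|w _].
  apply: measurable_fun_ifT => //.
  apply: (measurable_fun_bool true); rewrite setTI.
  rewrite (_ : _ @^-1` _ = [set w | cvgn (u ^~ w)]).
    exact: measurable_cvgn.
  by apply/seteqP; split => w /=; [exact: set_mem|exact: mem_set].
have [uw|uw] := pselect (cvgn (u ^~ w)).
  rewrite (_ : h ^~ w = u ^~ w)//.
  by apply/funext => n; rewrite /h mem_set.
rewrite (_ : h ^~ w = fun=> point); first by rewrite dvgP//; exact: cvg_cst.
by apply/funext => n; rewrite /h memNset.
Qed.

Lemma measurable_lim_series (u : nat -> T -> R) :
  (forall k, measurable_fun [set: T] (u k)) ->
  measurable_fun [set: T] (fun x => limn (series (fun k => u k x))).
Proof.
move=> mu; apply: (measurable_limn (u := fun m x => series (fun k => u k x) m)).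
by move=> m; apply: measurable_sum => k; exact: mu.
Qed.

End limits_of_measurable_functions.

Section subgaussian_series.
Context d (T : measurableType d) (R : realType) (P : probability T R).

Lemma markov_ge0 (mu : {measure set T -> \bar R}) (G : T -> \bar R) (a : R) : 0 < a ->
  measurable_fun [set: T] G -> (forall w, 0 <= G w)%E ->
  (mu [set w | a%:E <= G w] <= a^-1%:E * \int[mu]_w G w)%E.
Proof.
move=> a0 mG G0; have := le_integral_abse mu measurableT mG a0.
rewrite setTI; under eq_integral do rewrite gee0_abs//.
rewrite (_ : [set x | (a%:E <= `|G x|)%E] = [set w | (a%:E <= G w)%E]); last first.
  by apply/seteqP; split => w /=; rewrite gee0_abs.
move=> h; have ai0 : (0 <= a^-1%:E)%E by rewrite lee_fin invr_ge0 ltW.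
apply: le_trans (lee_wpmul2l ai0 h).
by rewrite muleA -EFinM mulVf ?gt_eqF// mul1e.
Qed.

Variables (xi : nat -> T -> R) (subg : subgaussian P xi).
Let mxi := subg.1.

Lemma measurable_partial_sum (b : nat -> R) i j :
  measurable_fun [set: T] (fun w => \sum_(i <= k < j) b k * xi k w).
Proof. by apply: measurable_sum => k; exact: measurable_funM. Qed.

Lemma subgaussian_range (b : nat -> R) i j :
  (\int[P]_w (expR (\sum_(i <= k < j) b k * xi k w))%:E <=
   (expR ((\sum_(i <= k < j) b k ^+ 2) / 2))%:E)%E.
Proof.
have := subg.2 (fun k => if (i <= k)%N then b k else 0) j.
under eq_integral => w _.
  have -> : \sum_(0 <= k < j) (if (i <= k)%N then b k else 0) * xi k w =
      \sum_(i <= k < j) b k * xi k w.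
    rewrite (@big_nat_widenl _ _ _ i 0%N)//= [RHS]big_mkcond/=.
    by apply: eq_bigr => k _; case: ifP; rewrite ?mul0r.
  over.
rewrite (@big_nat_widenl _ _ _ i 0%N)//= [in X in _ -> X]big_mkcond/=.
congr (_ <= (expR (_ / 2))%:E)%E.
by apply: eq_bigr => k _; case: ifP; rewrite ?expr0n.
Qed.

Let C4 : R := 4 ^+ 4 * (2 * expR (1 / 2)).

(** After normalization to [sum_k b_k^2 = 1], the bound of the fourth power by
    exponentials and the sub-Gaussian bound at b and - b give a constant. *)
Lemma subgaussian_fourth_moment (b : nat -> R) i j :
  (\int[P]_w ((\sum_(i <= k < j) b k * xi k w) ^+ 4)%:E <=
   (C4 * (\sum_(i <= k < j) b k ^+ 2) ^+ 2)%:E)%E.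
Proof.
set v := \sum_(i <= k < j) b k ^+ 2.
have v0 : 0 <= v by apply: sumr_ge0 => k _; exact: sqr_ge0.
have [vz|vn0] := eqVneq v 0.
  have bz : forall k, (i <= k < j)%N -> b k = 0.
    move=> k ikj; apply/eqP; rewrite -sqrf_eq0.
    move/eqP: vz; rewrite /v psumr_eq0; last by move=> l _; exact: sqr_ge0.
    by move=> /allP/(_ k); rewrite mem_index_iota ikj => /(_ isT).
  rewrite vz expr0n/= mulr0 integral0_eq// => w _.
  by rewrite big_nat big1 ?expr0n// => k /bz ->; rewrite mul0r.
pose s := Num.sqrt v.
have s0 : s != 0 by rewrite sqrtr_eq0 -ltNge lt_neqAle eq_sym vn0.
have s2 : s ^+ 2 = v by rewrite sqr_sqrtr.
have half : (\sum_(i <= k < j) (b k / s) ^+ 2) = 1.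
  under eq_bigr do rewrite expr_div_n s2.
  by rewrite -mulr_suml divff.
have halfN : (\sum_(i <= k < j) (- (b k / s)) ^+ 2) = 1.
  by under eq_bigr do rewrite sqrrN.
have E1 := subgaussian_range (fun k => b k / s) i j.
have E2 := subgaussian_range (fun k => - (b k / s)) i j.
rewrite half in E1; rewrite halfN in E2.
pose Y w := \sum_(i <= k < j) b k / s * xi k w.
have mY : measurable_fun [set: T] Y by exact: (measurable_partial_sum (fun k => b k / s)).
have K0 : 0 <= 4 ^+ 4 * v ^+ 2 by rewrite mulr_ge0 ?sqr_ge0// exprn_ge0.
apply: (@le_trans _ _ (\int[P]_w (4 ^+ 4 * v ^+ 2 * expR (Y w) +
   4 ^+ 4 * v ^+ 2 * expR (- Y w))%:E)%E).
  apply: ge0_le_integral => //.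
  - by move=> w _; rewrite lee_fin exprn_even_ge0.
  - apply/measurable_EFinP; apply: measurable_funX; exact: measurable_partial_sum.
  - apply/measurable_EFinP; apply: measurable_funD; apply: measurable_funM => //.
      exact: measurableT_comp.
    by apply: measurableT_comp => //; exact: measurable_funN.
  - move=> w _; rewrite lee_fin -mulrDr mulrAC.
    have -> : \sum_(i <= k < j) b k * xi k w = s * Y w.
      rewrite mulr_sumr; apply: eq_bigr => k _.
      by rewrite mulrA mulrCA divff ?mulr1.
    rewrite exprMn (_ : s ^+ 4 = v ^+ 2); last by rewrite -s2 -exprM.
    by rewrite mulrC ler_wpM2r ?sqr_ge0// pow4_le_expR.
have mexpY : measurable_fun [set: T] (fun w => expR (Y w)) by exact: measurableT_comp.
have mexpNY : measurable_fun [set: T] (fun w => expR (- Y w)).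
  by apply: measurableT_comp => //; exact: measurable_funN.
rewrite ge0_integral_lincomb//.
have E2' : (\int[P]_w (expR (- Y w))%:E <= (expR (1 / 2))%:E)%E.
  apply: le_trans E2; rewrite le_eqVlt; apply/orP; left; apply/eqP.
  apply: eq_integral => w _; rewrite /Y -sumrN.
  by congr (expR _)%:E; apply: eq_bigr => k _; rewrite mulNr.
apply: (@le_trans _ _ ((4 ^+ 4 * v ^+ 2)%:E * (expR (1 / 2))%:E +
  (4 ^+ 4 * v ^+ 2)%:E * (expR (1 / 2))%:E)%E).
  by apply: leeD; apply: lee_wpmul2l => //; rewrite lee_fin.
rewrite -!EFinM -EFinD lee_fin /C4.
by rewrite le_eqVlt; apply/orP; left; apply/eqP; ring.
Qed.

End subgaussian_series.

Lemma measurable_limn_einf d (T : measurableType d) (R : realType)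
    (f : nat -> T -> \bar R) :
  (forall n, measurable_fun [set: T] (f n)) ->
  measurable_fun [set: T] (fun w => limn_einf (f ^~ w)).
Proof.
move=> mf.
rewrite (_ : (fun w => _) = (fun w => - limn_esup (fun n => - f n w))%E).
  apply: (measurableT_comp (f := -%E)) => //.
  by apply: measurable_fun_limn_esup => n; exact: measurableT_comp.
apply/funext => w; rewrite -limn_einfN; congr limn_einf.
by apply/funext => n /=; rewrite oppeK.
Qed.

Section subgaussian_series_limit.
Context d (T : measurableType d) (R : realType) (P : probability T R).
Variables (xi : nat -> T -> R) (subg : subgaussian P xi).
Let mxi := subg.1.

(** By the maximal inequality and Markov's inequality, the probability that the
    partial sums after N ever deviate by more than e from the N-th one is at most
    [K (V - U_N)^2 / e^4], which tends to 0.  Hence the partial sums are almost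
    surely Cauchy. *)
Lemma subgaussian_series_cvg (b : nat -> R) :
  cvgn (series (fun k => b k ^+ 2)) ->
  {ae P, forall w, cvgn (series (fun k => b k * xi k w))}.
Proof.
move=> cb.
pose S n w := series (fun k => b k * xi k w) n.
pose U := series (fun k => b k ^+ 2).
pose V := limn U.
have mS n : measurable_fun [set: T] (S n) by exact: (measurable_partial_sum subg b 0 n).
have ndU : {homo U : i j / (i <= j)%N >-> i <= j}.
  by apply/nondecreasing_seqP => n; rewrite /U /series/= big_nat_recr//= lerDl sqr_ge0.
have UV n : U n <= V by exact: nondecreasing_cvgn_le.
pose C : R := 4 ^+ 4 * (2 * expR (1 / 2)).
have C0 : 0 <= C by rewrite !mulr_ge0 ?expR_ge0// exprn_ge0.
have [K hK] : exists K, 125 * C + 125 / 128 * K <= K.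
  by exists (125 * (128 * C)); lra.
have K0 : 0 <= K by lra.
have incr i j : (i <= j)%N ->
    (\int[P]_w ((S j w - S i w) ^+ 4)%:E <= (C * (U j - U i) ^+ 2)%:E)%E.
  move=> ij; rewrite /U sub_series_geq//.
  under eq_integral do rewrite /S sub_series_geq//.
  exact: subgaussian_fourth_moment.
clearbody C.
have maxi := maximal_fourth_moment C0 hK mS ndU incr.
pose e m : R := m.+1%:R^-1.
have e0 m : 0 < e m by rewrite invr_gt0.
have mA m N k : measurable [set w | e m < `|S (N + k)%N w - S N w|].
  have mf : measurable_fun [set: T] (fun w => `|S (N + k)%N w - S N w|).
    exact: (measurableT_comp (@normr_measurable R setT) (measurable_funB (mS _) (mS _))).
  by have := measurable_fun_ltr (measurable_cst (e m)) mf;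
    move=> /(_ measurableT [set true] Logic.I); rewrite setTI.
(* F m N n: a deviation larger than 1 / (m + 1) occurs between N and N + n. *)
pose F m N n := \bigcup_(k < n.+1) [set w | e m < `|S (N + k)%N w - S N w|].
have mF m N n : measurable (F m N n) by apply: bigcup_measurable => k _.
have PF m N n : (P (F m N n) <= ((e m ^+ 4)^-1 * (K * (V - U N) ^+ 2))%:E)%E.
  have [G [mG G0 GS EG]] := maxi n N.
  have e4 : 0 < e m ^+ 4 by rewrite exprn_gt0.
  apply: (@le_trans _ _ (P [set w | ((e m ^+ 4)%:E <= (G w)%:E)%E])).
    apply: le_measure; rewrite ?inE//.
      have := measurable_fun_ler (measurable_cst (e m ^+ 4)) mG.
      by move=> /(_ measurableT [set true] Logic.I); rewrite setTI.
    move=> w [k /= kn]; rewrite lee_fin => ek.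
    apply: le_trans (GS k w _); last by rewrite -ltnS.
    have -> : (S (N + k)%N w - S N w) ^+ 4 = `|S (N + k)%N w - S N w| ^+ 4.
      by rewrite -normrX ger0_norm// exprn_even_ge0.
    by rewrite lerXn2r ?nnegrE// ltW.
  have mGE : measurable_fun [set: T] (EFin \o G) by exact/measurable_EFinP.
  apply: le_trans (markov_ge0 P e4 mGE _) _; first by move=> w; rewrite lee_fin.
  rewrite EFinM; apply: lee_wpmul2l; first by rewrite lee_fin invr_ge0 ltW.
  apply: le_trans EG _; rewrite lee_fin ler_wpM2l// lerXn2r ?nnegrE ?subr_ge0//.
    exact/ndU/leq_addr.
  by rewrite lerD2r.
pose F' m N := \bigcup_n F m N n.
have mF' m N : measurable (F' m N) by apply: bigcupT_measurable.
have PF' m N : (P (F' m N) <= ((e m ^+ 4)^-1 * (K * (V - U N) ^+ 2))%:E)%E.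
  have ndF : {homo F m N : i j / (i <= j)%N >-> (i <= j)%O}.
    move=> i j ij; apply/subsetPset => w [k /= ki h]; exists k => //=.
    by rewrite (leq_trans ki).
  have cF := nondecreasing_cvg_mu (mu := P) (mF m N) (mF' m N) ndF.
  rewrite -(cvg_lim _ cF)//; apply: lime_le.
    by apply/cvg_ex; exists (P (F' m N)).
  by near=> n; exact: PF.
have PN m : P (\bigcap_N F' m N) = 0.
  have mI : measurable (\bigcap_N F' m N) by apply: bigcapT_measurable.
  have PI N : (P (\bigcap_N F' m N) <= ((e m ^+ 4)^-1 * (K * (V - U N) ^+ 2))%:E)%E.
    apply: le_trans (PF' m N); apply: le_measure; rewrite ?inE//.
    exact: bigcap_inf.
  apply/eqP; rewrite eq_le measure_ge0 andbT.
  have cU : ((e m ^+ 4)^-1 * (K * (V - U N) ^+ 2)) @[N --> \oo] --> (0 : R).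
    have -> : (0 : R) = (e m ^+ 4)^-1 * (K * (V - V) ^+ 2).
      by rewrite subrr expr0n/= !mulr0.
    apply: cvgMr; apply: cvgMr.
    rewrite expr2; under eq_fun do rewrite expr2.
    by apply: cvgM; (apply: cvgB; [exact: cvg_cst|exact: cb]).
  have fP : P (\bigcap_N F' m N) \is a fin_num by exact: fin_num_measure.
  rewrite -(fineK fP) lee_fin -(cvg_lim _ cU)//; apply: limr_ge.
    by apply/cvg_ex; exists 0.
  by near=> N; rewrite -lee_fin fineK.
have : P.-negligible (\bigcup_m \bigcap_N F' m N).
  apply: negligible_bigcup => m; exists (\bigcap_N F' m N).
  by split; [exact: bigcapT_measurable|exact: PN|].
move=> /negligibleS; apply => w /= nc.
apply: contrapT => h; apply: nc; apply/cvgn_cauchy_invS => m.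
apply: contrapT => h'; apply: h; exists m => // N _.
apply: contrapT => h2; apply: h'; exists N => k.
rewrite leNgt; apply/negP => h3; apply: h2.
by exists k => //; exists k => /=.
Unshelve. all: by end_near.
Qed.

Lemma measurable_series_lim (b : nat -> R) :
  measurable_fun [set: T] (fun w => limn (series (fun k => b k * xi k w))).
Proof.
apply: (measurable_lim_series (u := fun k w => b k * xi k w)) => k.
exact: measurable_funM.
Qed.

(** Fatou's lemma along the partial sums. *)
Lemma subgaussian_lim_expR (b : nat -> R) (V : R) :
  series (fun k => b k ^+ 2) @ \oo --> V ->
  (\int[P]_w (expR (limn (series (fun k => b k * xi k w))))%:E <=
   (expR (V / 2))%:E)%E.
Proof.
move=> cb.
pose S n w := series (fun k => b k * xi k w) n.
have mS n : measurable_fun [set: T] (fun w => (expR (S n w))%:E).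
  by apply/measurable_EFinP; apply: measurableT_comp => //; exact: (measurable_partial_sum subg b 0 n).
have UV n : series (fun k => b k ^+ 2) n <= V.
  rewrite -(cvg_lim _ cb)//; apply: nondecreasing_cvgn_le; last by apply/cvg_ex; exists V.
  by apply/nondecreasing_seqP => i; rewrite /series/= big_nat_recr//= lerDl sqr_ge0.
have -> : (\int[P]_w (expR (limn (series (fun k => b k * xi k w))))%:E =
    \int[P]_w limn_einf (fun n => (expR (S n w))%:E))%E.
  apply: ge0_ae_eq_integral => //.
  - apply/measurable_EFinP; apply: measurableT_comp => //.
    exact: measurable_series_lim.
  - exact: measurable_limn_einf.
  - move=> w _; rewrite limn_einf_lim; apply: lime_ge.
      exact: is_cvg_einfs.
    near=> n; apply: le_ereal_inf_tmp => _ [k /= _ <-].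
    by rewrite lee_fin expR_ge0.
  - have [] := @subgaussian_series_cvg b; first by apply/cvg_ex; exists V.
    move=> N [mN N0 hN].
    exists N; split => // w /= h; apply: hN => /= cw; apply: h => _.
    apply/esym; apply: (cvg_limn_einf_sup _).1.
    apply: cvg_EFin; first by near=> n.
    by apply: (continuous_cvg _ (@continuous_expR R _)).
apply: le_trans (fatou P measurableT mS _) _.
  by move=> n w _; rewrite lee_fin expR_ge0.
have bnd n : (\int[P]_w (expR (S n w))%:E <= (expR (V / 2))%:E)%E.
  apply: le_trans (subg.2 b n) _.
  by rewrite lee_fin ler_expR ler_pM2r// UV.
rewrite limn_einf_lim; apply: lime_le; first exact: is_cvg_einfs.
near=> n; apply: ge_ereal_inf; exists (\int[P]_w (expR (S n w))%:E)%E => //.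
by exists n => /=.
Unshelve. all: by end_near.
Qed.

End subgaussian_series_limit.

(** * Exponential moments of squares *)

Section exp_square.
Context d (T : measurableType d) (R : realType) (P : probability T R).

(** The square in the exponent is linearized: it is an average of exponentials
    of linear functions of x over an auxiliary normal variable. *)
Lemma exp_half_square (x : R) :
  (\int[normal_prob 0 1]_z (expR (x * z))%:E = (expR (x ^+ 2 / 2))%:E)%E.
Proof. by rewrite normal_mgf ?oner_eq0// mulr0 add0r expr1n mul1r. Qed.

Lemma exp_quarter_square :
  (\int[normal_prob 0 1]_z (expR (1 / 4 * z ^+ 2 : R))%:E = (Num.sqrt 2)%:E)%E.
Proof.
have q : 1 - 2 * (1 / 4) * 1 ^+ 2 = 2^-1 :> R by field.
rewrite normal_exp_square ?oner_eq0 ?q ?invr_gt0//.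
by rewrite sqrtrV// invrK.
Qed.

(** The squares are removed one at a time.  Each is replaced by an average over
    an independent normal variable z of [exp (z X_k)]; by Fubini's theorem the
    hypothesis applies with the coefficient z at X_k and leaves [exp (z^2 / 4)],
    whose mean is [sqrt 2].  The weight D absorbs the squares that remain to be
    treated. *)
Lemma integral_expR_square_le (k : nat) (X : nat -> T -> R) (D : T -> R) (kap : R) :
  (forall m, measurable_fun [set: T] (X m)) ->
  measurable_fun [set: T] D -> (forall w, 0 <= D w) ->
  0 <= kap ->
  (forall c : nat -> R,
    (\int[P]_w (D w * expR (\sum_(0 <= m < k) c m * X m w))%:E <=
     (kap * expR ((\sum_(0 <= m < k) c m ^+ 2) / 4))%:E)%E) ->
  (\int[P]_w (D w * expR ((\sum_(0 <= m < k) X m w ^+ 2) / 2))%:E <=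
   (kap * Num.sqrt 2 ^+ k)%:E)%E.
Proof.
move=> mX; elim: k D kap => [|k IH] D kap mD D0 kap0 h.
  under eq_integral do rewrite big_geq// mul0r expR0 mulr1.
  apply: le_trans (le_trans (h (fun=> 0)) _).
    rewrite le_eqVlt; apply/orP; left; apply/eqP; apply: eq_integral => w _.
    by rewrite big_geq// expR0 mulr1.
  by rewrite big_geq// mul0r expR0.
pose D' w := D w * expR (X k w ^+ 2 / 2).
have -> : (\int[P]_w (D w * expR ((\sum_(0 <= m < k.+1) X m w ^+ 2) / 2))%:E =
    \int[P]_w (D' w * expR ((\sum_(0 <= m < k) X m w ^+ 2) / 2))%:E)%E.
  apply: eq_integral => w _; rewrite /D' big_nat_recr//= mulrDl expRD.
  by congr EFin; ring.
rewrite exprS mulrA; apply: IH => //.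
- apply: measurable_funM => //; apply: measurableT_comp => //.
  by apply: measurable_funM => //; exact: measurable_funX.
- by move=> w; rewrite mulr_ge0 ?expR_ge0.
- by rewrite mulr_ge0 ?sqrtr_ge0.
move=> c; pose L w := \sum_(0 <= m < k) c m * X m w.
have mL : measurable_fun [set: T] L.
  by apply: measurable_sum => m; exact: measurable_funM.
pose f (z : T * measurableTypeR R) : \bar R :=
  (D z.1 * expR (L z.1) * expR (X k z.1 * z.2))%:E.
have mfst (g : T -> R) : measurable_fun [set: T] g ->
    measurable_fun [set: T * measurableTypeR R] (fun z => g z.1).
  by move=> mg; exact: measurableT_comp.
have mf : measurable_fun [set: T * measurableTypeR R] f.
  apply/measurable_EFinP; apply: measurable_funM.
    apply: measurable_funM; first exact: (mfst D).
    by apply: measurableT_comp => //; exact: (mfst L).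
  apply: measurableT_comp => //; apply: measurable_funM; first exact: (mfst (X k)).
  exact: measurable_snd.
have f0 z : (0 <= f z)%E by rewrite lee_fin !mulr_ge0 ?expR_ge0.
have -> : (\int[P]_w (D' w * expR (L w))%:E =
    \int[P]_w \int[normal_prob 0 1]_z f (w, z))%E.
  apply: eq_integral => w _; rewrite /f/=.
  under eq_integral do rewrite EFinM.
  rewrite ge0_integralZl_EFin//.
  - rewrite exp_half_square -EFinM /D'; congr EFin; ring.
  - apply/measurable_EFinP; apply: measurableT_comp => //; exact: mulrl_measurable.
  - by rewrite mulr_ge0 ?expR_ge0.
rewrite (fubini_tonelli f mf f0) /=.
set g := \sum_(0 <= m < k) c m ^+ 2.
apply: (@le_trans _ _ (\int[normal_prob 0 1]_z
    ((kap * expR (g / 4))%:E * (expR (1 / 4 * z ^+ 2))%:E))%E).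
  apply: ge0_le_integral => //.
  - by move=> z _; apply: integral_ge0 => w _; exact: f0.
  - exact: (measurable_fun_fubini_tonelli_G f mf f0).
  - apply: measurable_funeM; apply/measurable_EFinP; apply: measurableT_comp => //.
    by apply: measurable_funM => //; exact: exprn_measurable.
  - move=> z _.
    have := h (fun m => if m == k then z else c m).
    rewrite big_nat_recr//= eqxx (_ : \sum_(0 <= i < k) _ = g); last first.
      apply: eq_big_nat => i /andP[_ ik]; by rewrite (ltn_eqF ik).
    rewrite mulrDl expRD -EFinM => hz.
    rewrite mul1r (mulrC 4^-1); rewrite mulrA in hz.
    apply: le_trans hz; rewrite le_eqVlt; apply/orP; left; apply/eqP.
    apply: eq_integral => w _; rewrite /f/= big_nat_recr//= eqxx.
    rewrite (_ : \sum_(0 <= i < k) _ = L w); last first.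
      by apply: eq_big_nat => i /andP[_ ik]; rewrite (ltn_eqF ik).
    by rewrite expRD mulrA (mulrC z).
rewrite ge0_integralZl_EFin//.
- by rewrite exp_quarter_square -EFinM lee_fin mulrAC.
- apply/measurable_EFinP; apply: measurableT_comp => //.
  by apply: measurable_funM => //; exact: exprn_measurable.
- by rewrite mulr_ge0 ?expR_ge0.
Qed.

End exp_square.

Lemma cvg_series_finite_support (R : realType) (u : nat -> R) (N : nat) :
  (forall l, (N <= l)%N -> u l = 0) ->
  series u @ \oo --> \sum_(0 <= l < N) u l.
Proof.
move=> u0; apply: cvg_near_cst; exists N => // n /= Nn.
rewrite /series/= (big_cat_nat _ Nn)//= [X in _ + X](_ : _ = 0) ?addr0//.
by rewrite big_nat big1// => l /andP[Nl _]; exact: u0.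
Qed.

Section tilted_square.
Context d (T : measurableType d) (R : realType) (P : probability T R).
Variables (xi : nat -> T -> R) (subg : subgaussian P xi).
Let mxi := subg.1.

(** Under the measure with density [exp (sum_l b_l xi_l - V / 2)], the variables
    [xi_l - b_l] are again sub-Gaussian: multiplying the density by
    [exp (sum_l h_l xi_l)] replaces b by [b + h], which changes V by
    [2 <h, b> + |h|^2].  The cross term is the mean shift, and the hypothesis on a
    bounds [|h|^2 / 2] by a quarter of [|c|^2]. *)
Lemma tilted_expR_square_le (b : nat -> R) (V : R) (k N : nat) (a : nat -> nat -> R) :
  series (fun l => b l ^+ 2) @ \oo --> V ->
  (forall c : nat -> R,
    \sum_(0 <= l < N) (\sum_(0 <= m < k) c m * a m l) ^+ 2 <=
    (\sum_(0 <= m < k) c m ^+ 2) / 2) ->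
  (\int[P]_w (expR (limn (series (fun l => b l * xi l w)) - V / 2) *
    expR ((\sum_(0 <= m < k) (\sum_(0 <= l < N) a m l * xi l w -
      \sum_(0 <= l < N) a m l * b l) ^+ 2) / 2))%:E <= (Num.sqrt 2 ^+ k)%:E)%E.
Proof.
move=> cb ha.
pose X m w := \sum_(0 <= l < N) a m l * xi l w - \sum_(0 <= l < N) a m l * b l.
pose D w := expR (limn (series (fun l => b l * xi l w)) - V / 2).
rewrite -[X in (_ <= X%:E)%E]mul1r.
have mlim := measurable_series_lim subg b.
have mX m : measurable_fun [set: T] (X m).
  by apply: measurable_funB => //; exact: (measurable_partial_sum subg (a m) 0 N).
have mD : measurable_fun [set: T] D.
  by apply: measurableT_comp => //; exact: measurable_funB.
apply: (integral_expR_square_le (X := X) (D := D)) => //.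
- by move=> w; exact: expR_ge0.
move=> c; rewrite mul1r.
pose h l := if (l < N)%N then \sum_(0 <= m < k) c m * a m l else 0.
pose hb := \sum_(0 <= l < N) h l * b l.
pose hh := \sum_(0 <= l < N) h l ^+ 2.
have cbh : series (fun l => (b l + h l) ^+ 2) @ \oo --> V + 2 * hb + hh.
  have -> : series (fun l => (b l + h l) ^+ 2) =
      series (fun l => b l ^+ 2) + series (fun l => 2 * (h l * b l) + h l ^+ 2).
    apply/funext => n; rewrite /series/= fctE -big_split/=.
    by apply: eq_bigr => l _; ring.
  rewrite -addrA; apply: cvgD => //.
  have -> : 2 * hb + hh = \sum_(0 <= l < N) (2 * (h l * b l) + h l ^+ 2).
    by rewrite big_split/= -mulr_sumr.
  apply: cvg_series_finite_support => l Nl.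
  by rewrite /h ltnNge Nl/= mul0r mulr0 expr0n addr0.
have := subgaussian_lim_expR subg cbh => Ebh.
have Xh w : \sum_(0 <= m < k) c m * X m w = \sum_(0 <= l < N) h l * xi l w - hb.
  rewrite /X; under eq_bigr do rewrite mulrBr !mulr_sumr.
  rewrite sumrB; congr (_ - _); rewrite exchange_big/= /hb.
    apply: eq_big_nat => l /andP[_ lN]; rewrite /h lN mulr_suml.
    by apply: eq_bigr => m _; rewrite mulrA.
  apply: eq_big_nat => l /andP[_ lN]; rewrite /h lN mulr_suml.
  by apply: eq_bigr => m _; rewrite mulrA.
have -> : (\int[P]_w (D w * expR (\sum_(0 <= m < k) c m * X m w))%:E =
    \int[P]_w ((expR (- V / 2 - hb))%:E *
     (expR (limn (series (fun l => (b l + h l) * xi l w))))%:E))%E.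
  apply: ge0_ae_eq_integral => //.
  - apply/measurable_EFinP; apply: measurable_funM => //; apply: measurableT_comp => //.
    by apply: measurable_sum => m; exact: measurable_funM.
  - apply: measurable_funeM; apply/measurable_EFinP; apply: measurableT_comp => //.
    exact: (measurable_series_lim subg (fun l => b l + h l)).
  - by move=> w _; rewrite lee_fin mulr_ge0 ?expR_ge0.
  - have [] := subgaussian_series_cvg subg (b := b); first by apply/cvg_ex; exists V.
    move=> Nn [mN N0 hN]; exists Nn; split => // w /= nh; apply: hN => /= cw; apply: nh => _.
    rewrite -EFinM -!expRD Xh; congr (expR _)%:E.
    have -> : limn (series (fun l => (b l + h l) * xi l w)) =
       limn (series (fun l => b l * xi l w)) + \sum_(0 <= l < N) h l * xi l w.
      apply: cvg_lim => //.
      have -> : series (fun l => (b l + h l) * xi l w) =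
          series (fun l => b l * xi l w) + series (fun l => h l * xi l w).
        apply/funext => n; rewrite /series/= fctE -big_split/=.
        by apply: eq_bigr => l _; rewrite mulrDl.
      apply: cvgD; first exact: cw.
      apply: cvg_series_finite_support => l Nl.
      by rewrite /h ltnNge Nl/= mul0r.
    by ring.
rewrite ge0_integralZl_EFin ?expR_ge0//; last first.
  apply/measurable_EFinP; apply: measurableT_comp => //.
  exact: (measurable_series_lim subg (fun l => b l + h l)).
apply: le_trans (lee_wpmul2l _ Ebh) _; first by rewrite lee_fin expR_ge0.
rewrite -EFinM -expRD lee_fin ler_expR.
have : hh <= (\sum_(0 <= m < k) c m ^+ 2) / 2.
  apply: le_trans (ha c); rewrite /hh le_eqVlt; apply/orP; left; apply/eqP.
  by apply: eq_big_nat => l /andP[_ lN]; rewrite /h lN.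
by move: (\sum_(0 <= m < k) _) => s; lra.
Qed.

(** The case of no squares. *)
Lemma tilted_expR_le (b : nat -> R) (V : R) :
  series (fun l => b l ^+ 2) @ \oo --> V ->
  (\int[P]_w (expR (limn (series (fun l => b l * xi l w)) - V / 2))%:E <= 1)%E.
Proof.
move=> cb.
have := @tilted_expR_square_le b V 0 0 (fun _ _ => 0) cb.
rewrite expr0 => h; apply: le_trans (h _); last first.
  by move=> c; rewrite !big_geq// mul0r.
rewrite le_eqVlt; apply/orP; left; apply/eqP; apply: eq_integral => w _.
by rewrite big_geq// mul0r expR0 mulr1.
Qed.

End tilted_square.

(** * Orthonormal bases *)

Section orthonormal_sequences.
Context (R : realType) (H : completeNormedModType R) (ip : {dot H for idfun}).

Lemma ipC (x y : H) : ip x y = ip y x.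
Proof. by rewrite hermC expr0 mul1r. Qed.

Lemma ip_ge0 (x : H) : 0 <= ip x x.
Proof. by have [->|/neq0_dnorm_gt0/ltW//] := eqVneq x 0; rewrite linear0l. Qed.

Lemma ip_suml (I : Type) (r : seq I) (a : I -> R) (u : I -> H) (y : H) :
  ip (\sum_(i <- r) a i *: u i) y = \sum_(i <- r) a i * ip (u i) y.
Proof.
by rewrite linear_sumlz; apply: eq_bigr => i _; rewrite linearZl_LR.
Qed.

(** Coefficients indexed by all of nat allow spans of different lengths to be
    compared without casts. *)
Lemma lin_spanP (u : nat -> H) (m : nat) (v : H) :
  lin_span u m v <-> exists a : nat -> R, v = \sum_(0 <= i < m) a i *: u i.
Proof.
split => [[a ->]|[a ->]].
- exists (fun i => oapp a 0 (insub i)); rewrite big_mkord.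
  by apply: eq_bigr => i _; rewrite valK.
- by exists (fun i => a i); rewrite big_mkord.
Qed.

Variable u : nat -> H.
Hypothesis orth : forall i j, ip (u i) (u j) = (i == j)%:R.

Lemma ip_lincomb (a : nat -> R) (K j : nat) :
  ip (\sum_(0 <= i < K) a i *: u i) (u j) = if (j < K)%N then a j else 0.
Proof.
rewrite ip_suml; case: ifPn => jK.
  rewrite (bigD1_seq j) ?mem_index_iota ?iota_uniq//= orth eqxx mulr1 big1 ?addr0//.
  by move=> i ij; rewrite orth (negbTE ij) mulr0.
rewrite big_nat big1// => i /andP[_ iK]; rewrite orth.
by case: eqP => [ij|_]; rewrite ?mulr0//; rewrite -ij iK in jK.
Qed.

Lemma ip_lincomb_norm (a : nat -> R) (K : nat) :
  let w := \sum_(0 <= i < K) a i *: u i in ip w w = \sum_(0 <= i < K) a i ^+ 2.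
Proof.
move=> w; rewrite {1}/w ip_suml; apply: eq_big_nat => i /andP[_ iK].
by rewrite ipC ip_lincomb iK expr2.
Qed.

(** Pythagoras: among the linear combinations of the [u i], i < K, the one with
    the Fourier coefficients of v is the closest to v. *)
Lemma ip_lincomb_sqr (a : nat -> R) (K : nat) (v : H) :
  let w := \sum_(0 <= i < K) a i *: u i in
  ip (v - w) (v - w) = ip v v - \sum_(0 <= i < K) ip v (u i) ^+ 2 +
    \sum_(0 <= i < K) (a i - ip v (u i)) ^+ 2.
Proof.
move=> w.
have ww : ip w w = \sum_(0 <= i < K) a i ^+ 2 by exact: ip_lincomb_norm.
have wv : ip w v = \sum_(0 <= i < K) a i * ip v (u i).
  by rewrite /w ip_suml; apply: eq_bigr => i _; rewrite (ipC v).
rewrite linearBl !linearBr /= (ipC v w) ww wv.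
under [X in _ = _ + X]eq_bigr do rewrite sqrrB.
rewrite big_split/= sumrB.
have -> : \sum_(0 <= i < K) (a i * ip v (u i)) *+ 2 =
  2 * \sum_(0 <= i < K) a i * ip v (u i).
  by rewrite mulr_sumr; apply: eq_bigr => i _; rewrite mulr_natl.
ring.
Qed.

Lemma bessel (v : H) (K : nat) : \sum_(0 <= i < K) ip v (u i) ^+ 2 <= ip v v.
Proof.
have := ip_ge0 (v - \sum_(0 <= i < K) ip v (u i) *: u i).
rewrite ip_lincomb_sqr [X in _ + X]big1 => [|i _]; last by rewrite subrr expr0n.
by rewrite addr0 subr_ge0.
Qed.

End orthonormal_sequences.

Section orthonormal_basis.
Context (R : realType) (H : completeNormedModType R) (ip : {dot H for idfun}).
Hypothesis normE : forall x : H, `|x| = Num.sqrt (ip x x).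

Lemma norm_sqr (x : H) : `|x| ^+ 2 = ip x x.
Proof. by rewrite normE sqr_sqrtr// ip_ge0. Qed.

Variable u : nat -> H.
Hypothesis bu : orthonormal_basis ip u.
Let orth := bu.1.

(** Some finite linear combination is close to v by density, and the Fourier sums
    of at least the same length are closer still, being best approximations. *)
Lemma fourier_cvg (v : H) :
  (fun K => \sum_(0 <= i < K) ip v (u i) *: u i) @ \oo --> v.
Proof.
apply/cvgrPdist_lt => e e0.
have [|w [vw [m _ wm]]] := bu.2 (ball v e) _ (ball_open v e).
  by exists v; exact: ballxx.
have [a wE] := (lin_spanP u m w).1 wm.
exists m => // K /= mK.
have h0 : \sum_(0 <= i < K) (ip v (u i) - ip v (u i)) ^+ 2 = 0.
  by apply: big1 => i _; rewrite subrr expr0n.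
have {}vw : `|v - w| < e by move: vw; rewrite -ball_normE.
apply: le_lt_trans vw.
rewrite -(@ler_pXn2r _ 2)// ?nnegrE// !norm_sqr wE !ip_lincomb_sqr// h0 addr0.
apply: (@le_trans _ _ (ip v v - \sum_(0 <= i < m) ip v (u i) ^+ 2)).
  rewrite lerD2l lerN2 (big_cat_nat _ mK)//= lerDl.
  by apply: sumr_ge0 => i _; exact: sqr_ge0.
by rewrite lerDl; apply: sumr_ge0 => i _; exact: sqr_ge0.
Qed.

Lemma parseval (v : H) : series (fun k => ip v (u k) ^+ 2) @ \oo --> `|v| ^+ 2.
Proof.
have h : `|\sum_(0 <= i < K) ip v (u i) *: u i| @[K --> \oo] --> `|v|.
  by apply: cvg_norm; exact: fourier_cvg.
have -> : series (fun k => ip v (u k) ^+ 2) =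
    (fun K => `|\sum_(0 <= i < K) ip v (u i) *: u i| *
      `|\sum_(0 <= i < K) ip v (u i) *: u i|).
  by apply/funext => K; rewrite -expr2 norm_sqr ip_lincomb_norm.
by rewrite expr2; apply: cvgM.
Qed.

Lemma finite_expansion (v : H) (N : nat) :
  (forall l, (N <= l)%N -> ip v (u l) = 0) ->
  v = \sum_(0 <= i < N) ip v (u i) *: u i.
Proof.
move=> v0; apply/esym; apply: cvg_unique (@fourier_cvg v) => //=.
apply: cvg_near_cst; exists N => // n /= Nn.
rewrite (big_cat_nat _ Nn)//= [X in _ + X](_ : _ = 0) ?addr0//.
by rewrite big_nat big1// => l /andP[Nl _]; rewrite v0// scale0r.
Qed.

Lemma orthogonal_projectionE (m : nat) (Q : H -> H) (f : H) :
  is_orthogonal_projection ip (lin_span u m) Q ->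
  Q f = \sum_(0 <= i < m) ip f (u i) *: u i.
Proof.
move=> /(_ f)[/lin_spanP[a Qf] Qo]; rewrite Qf; apply: eq_big_nat => i /andP[_ im].
have : ip (f - Q f) (u i) = 0.
  apply: Qo; apply/lin_spanP; exists (fun j => (j == i)%:R).
  rewrite (bigD1_seq i) ?mem_index_iota ?iota_uniq//= eqxx scale1r big1 ?addr0//.
  by move=> j /negbTE ->; rewrite scale0r.
rewrite linearBl/= Qf ip_lincomb// im => /eqP; rewrite subr_eq0 => /eqP <-.
by [].
Qed.

Lemma projection_dist_sqr (m : nat) (Q : H -> H) (f f0 : H) :
  is_orthogonal_projection ip (lin_span u m) Q ->
  `|Q f - Q f0| ^+ 2 = \sum_(0 <= i < m) ip (f - f0) (u i) ^+ 2.
Proof.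
move=> hQ; rewrite !(orthogonal_projectionE _ hQ) norm_sqr -sumrB.
under eq_bigr do rewrite -scalerBl.
rewrite ip_lincomb_norm//; apply: eq_bigr => i _; by rewrite linearBl.
Qed.

End orthonormal_basis.

(** * The operator in its singular basis *)

Section operator.
Context (R : realType) (H1 H2 : completeNormedModType R).
Context (ip1 : {dot H1 for idfun}) (ip2 : {dot H2 for idfun}).
Hypothesis norm1E : forall x : H1, `|x| = Num.sqrt (ip1 x x).
Hypothesis norm2E : forall x : H2, `|x| = Num.sqrt (ip2 x x).
Variables (A : {linear H1 -> H2}) (Astar : H2 -> H1).
Hypotheses (hAinj : injective A) (hAcont : continuous A).
Hypothesis hAstar : is_adjoint ip1 ip2 A Astar.
Variables (e : nat -> H1) (rho : nat -> R) (g : nat -> H2).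
Hypothesis he : orthonormal_basis ip1 e.
Hypothesis hrho : forall k, Astar (A (e k)) = rho k ^+ 2 *: e k.
Hypothesis hg : forall k, A (e k) = rho k *: g k.

(** Otherwise A would kill the unit vector e k. *)
Lemma singular_value_neq0 k : rho k != 0.
Proof.
apply/eqP => rk; have := hg k; rewrite rk scale0r -(linear0 A) => /hAinj ek.
have := he.1 k k; rewrite ek linear0l eqxx => /esym/eqP.
by rewrite oner_eq0.
Qed.

(** The adjoint relation gives [rho_k <A f, g_k> = <f, A* A e_k>]; divide by
    rho_k. *)
Lemma ip_image_singular f k : ip2 (A f) (g k) = rho k * ip1 f (e k).
Proof.
have rk := singular_value_neq0 k.
apply: (mulfI rk); rewrite -linearZr_LR /= -hg hAstar hrho linearZr_LR/=.
by rewrite expr2 mulrA.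
Qed.

Lemma conjugate_orthonormal i j : ip2 (g i) (g j) = (i == j)%:R.
Proof.
have ri := singular_value_neq0 i.
apply: (mulfI ri); rewrite -linearZl_LR /= -hg ip_image_singular he.1.
by have [->|] := eqVneq i j; rewrite ?mulr1// mulr0 mulr0.
Qed.

(** A is continuous, so the norms of the images of the Fourier sums of f converge;
    these images are combinations of the orthonormal vectors g. *)
Lemma image_parseval f :
  series (fun k => (rho k * ip1 f (e k)) ^+ 2) @ \oo --> `|A f| ^+ 2.
Proof.
have h : `|A (\sum_(0 <= i < K) ip1 f (e i) *: e i)| @[K --> \oo] --> `|A f|.
  apply: cvg_norm.
  exact: (continuous_cvg _ (@hAcont f) (@fourier_cvg _ _ _ norm1E _ he f)).
have -> : series (fun k => (rho k * ip1 f (e k)) ^+ 2) =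
    (fun K => `|A (\sum_(0 <= i < K) ip1 f (e i) *: e i)| *
      `|A (\sum_(0 <= i < K) ip1 f (e i) *: e i)|).
  apply/funext => K; rewrite -expr2 (norm_sqr norm2E).
  have -> : A (\sum_(0 <= i < K) ip1 f (e i) *: e i) =
      \sum_(0 <= i < K) (rho i * ip1 f (e i)) *: g i.
    rewrite linear_sum; apply: eq_bigr => i _.
    by rewrite linearZ/= hg scalerA mulrC.
  by rewrite ip_lincomb_norm//; exact: conjugate_orthonormal.
by rewrite expr2; apply: cvgM.
Qed.

Variable phi : nat -> H1.
Hypothesis hphi : orthonormal_basis ip1 phi.
Hypothesis hphi_fin :
  forall k, finite_set [set l | `|ip1 (phi k) (e l)| != 0].

Lemma active_indices_bounded k :
  exists N, forall m l, (m < k)%N -> (N <= l)%N -> ip1 (phi m) (e l) = 0.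
Proof.
elim: k => [|k [N hN]]; first by exists 0%N.
have [M hM] : exists M, forall l, (M <= l)%N -> ip1 (phi k) (e l) = 0.
  have /finite_seqP[s sE] := hphi_fin k.
  exists (\max_(x <- s) x).+1 => l sl; apply/eqP; rewrite -normr_eq0.
  apply/negPn/negP => hl; have : [set` s] l by rewrite -sE.
  move=> /= ls; have := @leq_bigmax_seq _ s predT id l ls isT.
  by rewrite leqNgt sl.
exists (maxn N M) => m l; rewrite ltnS leq_eqVlt geq_max => /orP[/eqP ->|mk] /andP[Nl Ml].
  exact: hM.
exact: hN.
Qed.

(** Finitely many indices are active and no singular value vanishes.  The infimum
    is not that of the empty set, as the unit vector [phi 0] has a nonzero
    coordinate. *)
Lemma delta_inf_gt0 k : (0 < k)%N -> 0 < delta_inf ip1 phi e rho k.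
Proof.
move=> k0; have [N hN] := active_indices_bounded k.
have [mu mu0 hmu] : exists2 mu : R, 0 < mu & forall l, (l < N)%N -> mu <= `|rho l|.
  elim: {hN} N => [|N [mu mu0 hmu]]; first by exists 1.
  exists (Num.min mu `|rho N|).
    by rewrite lt_min mu0 normr_gt0 singular_value_neq0.
  move=> l; rewrite ltnS leq_eqVlt ge_min => /orP[/eqP ->|/hmu ->//].
  by rewrite lexx orbT.
apply: (lt_le_trans mu0); apply: lb_le_inf.
  apply: contrapT => h.
  have z l : ip1 (phi 0) (e l) = 0.
    apply: contrapT => hl; apply: h; exists `|rho l|; exists l => //.
    by exists 0%N; split => //; rewrite normr_eq0; apply/eqP.
  have := hphi.1 0%N 0%N.
  rewrite (finite_expansion norm1E he (N := 0) (v := phi 0)) ?big_geq//.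
  by rewrite linear0l eqxx => /esym/eqP; rewrite oner_eq0.
move=> _ [l [m [mk hl]] <-]; apply: hmu; rewrite ltnNge; apply/negP => Nl.
by move: hl; rewrite (hN _ _ mk Nl) normr0 eqxx.
Qed.

Lemma delta_inf_le k m l : (m < k)%N -> ip1 (phi m) (e l) != 0 ->
  delta_inf ip1 phi e rho k <= `|rho l|.
Proof.
move=> mk hl; apply: ge_inf; first by exists 0 => _ [i _ <-].
by exists l => //; exists m; split => //; rewrite normr_eq0.
Qed.

(** Applying the inverse of A to a combination v of the first k vectors phi
    divides its coordinates by singular values that are at least
    [delta_inf] in absolute value; the factor th compensates this and yields the
    extra factor 1/2. *)
Lemma test_vectors_contract k N (th : R) (c : nat -> R) : (0 < k)%N ->
  (forall m l, (m < k)%N -> (N <= l)%N -> ip1 (phi m) (e l) = 0) ->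
  th ^+ 2 = delta_inf ip1 phi e rho k ^+ 2 / 2 ->
  \sum_(0 <= l < N) (\sum_(0 <= m < k) c m * (th * (ip1 (phi m) (e l) / rho l))) ^+ 2
  <= (\sum_(0 <= m < k) c m ^+ 2) / 2.
Proof.
move=> k0 hN th2; set de := delta_inf _ _ _ _ _ in th2 *.
have de0 : 0 < de by exact: delta_inf_gt0.
pose v := \sum_(0 <= m < k) c m *: phi m.
apply: (@le_trans _ _ (\sum_(0 <= l < N) ip1 v (e l) ^+ 2 / 2)); last first.
  rewrite -mulr_suml ler_pM2r// (le_trans (bessel he.1 _ _))//.
  by rewrite ip_lincomb_norm//; exact: hphi.1.
apply: ler_sum => l _.
have vl : ip1 v (e l) = \sum_(0 <= m < k) c m * ip1 (phi m) (e l) by rewrite ip_suml.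
have -> : \sum_(0 <= m < k) c m * (th * (ip1 (phi m) (e l) / rho l)) =
    th * (ip1 v (e l) / rho l).
  by rewrite vl mulr_suml mulr_sumr; apply: eq_bigr => m _; ring.
have [->|vl0] := eqVneq (ip1 v (e l)) 0; first by rewrite !mul0r mulr0 expr0n/= mul0r.
have [m mk ml] : exists2 m, (m < k)%N & ip1 (phi m) (e l) != 0.
  apply: contrapT => h; move/eqP: vl0; apply; rewrite vl big_nat big1// => m /andP[_ mk].
  have [->|h2] := eqVneq (ip1 (phi m) (e l)) 0; first by rewrite mulr0.
  by exfalso; apply: h; exists m.
have dr : de <= `|rho l| by exact: delta_inf_le mk ml.
have r2 : de ^+ 2 <= rho l ^+ 2.
  by rewrite -[leRHS]real_normK ?num_real// lerXn2r ?nnegrE// ltW.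
have r20 : 0 < rho l ^+ 2 by rewrite exprn_even_gt0//= singular_value_neq0.
rewrite exprMn expr_div_n th2.
rewrite mulrCA -[leRHS]mulr1 -mulrA.
have -> : de ^+ 2 / 2 * (rho l ^+ 2)^-1 = (de ^+ 2 / rho l ^+ 2) / 2 by ring.
rewrite ler_wpM2l ?sqr_ge0//.
by rewrite mulr1 -[leRHS]mul1r ler_pM2r// ler_pdivrMr// mul1r.
Qed.

End operator.

(** * Tails of a posterior distribution *)

Lemma ge0_integral_indic d (T : measurableType d) (R : realType)
    (mu : {measure set T -> \bar R}) (S : set T) (h : T -> R) :
  (\int[mu]_(x in S) (h x)%:E = \int[mu]_x (h x * \1_S x)%:E)%E.
Proof.
rewrite integral_mkcond; apply: eq_integral => x _.
rewrite patchE indicE; case: ifPn => _; first by rewrite mulr1.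
by rewrite mulr0.
Qed.

Section bayes.
Context (R : realType) d1 (O : measurableType d1) (P : probability O R).
Context d2 (Th : measurableType d2) (Pi : probability Th R).

Lemma measurable_integral_section (h : O * Th -> R) :
  measurable_fun [set: O * Th] h -> (forall z, 0 <= h z) ->
  measurable_fun [set: O] (fun w => \int[Pi]_f (h (w, f))%:E)%E.
Proof.
move=> mh h0.
apply: (measurable_fun_fubini_tonelli_F (m2 := Pi) (fun z => (h z)%:E)).
  exact/measurable_EFinP.
by move=> z; rewrite lee_fin.
Qed.

(** Tonelli's theorem: a bound on the expectation for each parameter f integrates
    to a bound on the expectation of the integral over f. *)
Lemma expectation_integral_le (h : O * Th -> R) (S : set Th) (g : Th -> R) :
  measurable S ->
  measurable_fun [set: O * Th] h -> (forall z, 0 <= h z) ->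
  measurable_fun [set: Th] g -> (forall f, 0 <= g f) ->
  (forall f, S f -> (\int[P]_w (h (w, f))%:E <= (g f)%:E)%E) ->
  (\int[P]_w \int[Pi]_(f in S) (h (w, f))%:E <= \int[Pi]_(f in S) (g f)%:E)%E.
Proof.
move=> mS mh h0 mg g0 hg.
under eq_integral do rewrite ge0_integral_indic.
have mS' : measurable_fun [set: O * Th] (fun z => h z * \1_S z.2 : R).
  apply: measurable_funM => //.
  by apply: measurableT_comp => //; exact: measurable_indic.
rewrite (fubini_tonelli (fun z => (h z * \1_S z.2)%:E)) /=; last 2 first.
- exact/measurable_EFinP.
- by move=> z; rewrite lee_fin mulr_ge0.
rewrite ge0_integral_indic; apply: ge0_le_integral => //.
- by move=> f _; apply: integral_ge0 => w _; rewrite lee_fin mulr_ge0.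
- apply: (measurable_fun_fubini_tonelli_G (m1 := P) (fun z => (h z * \1_S z.2)%:E)).
    exact/measurable_EFinP.
  by move=> z; rewrite lee_fin mulr_ge0.
- by apply/measurable_EFinP; apply: measurable_funM => //; exact: measurable_indic.
- move=> f _; rewrite indicE; have [fS|fS] := boolP (f \in S).
    rewrite mulr1; under eq_integral do rewrite mulr1.
    by apply: hg; rewrite inE in fS.
  rewrite mulr0; under eq_integral do rewrite mulr0.
  by rewrite integral0.
Qed.

Variables (ell : O * Th -> R) (ell0 : O -> R).
Hypotheses (mell : measurable_fun [set: O * Th] ell).
Hypotheses (mell0 : measurable_fun [set: O] ell0).
Variables (Pc S Ball Sieve : set Th) (G : set O).
Hypotheses (mPc : measurable Pc) (mS : measurable S) (mBall : measurable Ball)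
  (mSieve : measurable Sieve) (mG : measurable G).
Hypotheses (SPc : S `<=` Pc) (BallPc : Ball `<=` Pc).
Variables (r alpha beta eta : R).
Hypotheses (beta0 : 0 < beta) (eta0 : 0 < eta) (alpha0 : 0 <= alpha).
(* The function ell0 plays the role of the log-likelihood of the true
   parameter, so that lr is the log-likelihood ratio. *)
Let lr w f := ell (w, f) - ell0 w.
Hypothesis normalized : forall f, Pc f -> (\int[P]_w (expR (lr w f))%:E <= 1)%E.
Hypothesis tested : forall f, S f -> Sieve f ->
  (\int[P]_w (expR (lr w f) * \1_G w)%:E <= alpha%:E)%E.
Hypothesis close : forall f, Ball f ->
  (\int[P]_w (expR (- lr w f))%:E <= (expR r)%:E)%E.
Hypothesis sieve_mass : (Pi (Pc `\` Sieve) <= alpha%:E)%E.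
Hypothesis ball_mass : (beta%:E <= Pi Ball)%E.

Let mlr : measurable_fun [set: O * Th] (fun z => lr z.1 z.2).
Proof.
apply: measurable_funB; last exact: measurableT_comp.
by rewrite (_ : (fun z => _) = ell)//; apply/funext => -[].
Qed.

Let mE : measurable_fun [set: O * Th] (fun z => expR (lr z.1 z.2)).
Proof. exact: measurableT_comp. Qed.

Let mEN : measurable_fun [set: O * Th] (fun z => expR (- lr z.1 z.2)).
Proof. by apply: measurableT_comp => //; exact: measurable_funN. Qed.

Let post w := (\int[Pi]_(f in S) expR (ell (w, f))) /
  (\int[Pi]_(f in Pc) expR (ell (w, f))).

Lemma measurable_integral_section_in (h : O * Th -> R) (D : set Th) : measurable D ->
  measurable_fun [set: O * Th] h -> (forall z, 0 <= h z) ->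
  measurable_fun [set: O] (fun w => \int[Pi]_(f in D) (h (w, f))%:E)%E.
Proof.
move=> mD mh h0; under eq_fun do rewrite ge0_integral_indic.
apply: (measurable_integral_section (h := fun z => h z * \1_D z.2)).
  apply: measurable_funM => //.
  by apply: measurableT_comp => //; exact: measurable_indic.
by move=> z; rewrite mulr_ge0.
Qed.

(** The integrals of real-valued functions in [post] are 0 when the extended
    integrals are infinite, and division by 0 gives 0.  A posterior that is not small
    therefore has a positive and finite denominator. *)
Let num_den w : eta <= `|post w| <->
  eta * (\int[Pi]_(f in Pc) expR (ell (w, f))) <= \int[Pi]_(f in S) expR (ell (w, f)) /\
  0 < \int[Pi]_(f in Pc) expR (ell (w, f)).
Proof.
rewrite /post; set A := (\int[Pi]_(f in S) _); set B := (\int[Pi]_(f in Pc) _).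
have A0 : 0 <= A by apply: fine_ge0; apply: integral_ge0 => f _; rewrite lee_fin expR_ge0.
have B0 : 0 <= B by apply: fine_ge0; apply: integral_ge0 => f _; rewrite lee_fin expR_ge0.
rewrite ger0_norm ?divr_ge0//; split => [h|[h Bp]]; last by rewrite ler_pdivlMr.
have Bp : 0 < B.
  rewrite lt_neqAle B0 andbT; apply/eqP => Bz; move: h.
  by rewrite -Bz invr0 mulr0 leNgt eta0.
by split => //; rewrite -ler_pdivlMr.
Qed.

Lemma posterior_event_measurable : measurable [set w | eta <= `|post w|].
Proof.
pose A w := \int[Pi]_(f in S) expR (ell (w, f)).
pose B w := \int[Pi]_(f in Pc) expR (ell (w, f)).
have mAB D : measurable D ->
    measurable_fun [set: O] (fun w => \int[Pi]_(f in D) expR (ell (w, f))).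
  move=> mD; apply: (measurableT_comp (@fine_measurable R setT measurableT)).
  apply: (measurable_integral_section_in (h := fun z => expR (ell z))) => //.
  - exact: measurableT_comp.
have -> : [set w | eta <= `|post w|] =
    [set w | eta * B w <= A w] `&` [set w | 0 < B w].
  by apply/seteqP; split => w /= /num_den.
have mA : measurable_fun [set: O] A by exact: mAB.
have mB : measurable_fun [set: O] B by exact: mAB.
apply: measurableI.
- have mBe : measurable_fun [set: O] (fun w => eta * B w) by exact: measurable_funM.
  have := measurable_fun_ler mBe mA.
  by move=> /(_ measurableT [set true] Logic.I); rewrite setTI.
- have := measurable_fun_ltr (measurable_cst (0 : R)) mB.
  by move=> /(_ measurableT [set true] Logic.I); rewrite setTI.
Qed.

Let PB := fine (Pi Ball).
Let PBE : Pi Ball = PB%:E. Proof. by rewrite fineK// fin_num_measure. Qed.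
Let betaPB : beta <= PB. Proof. by rewrite -lee_fin -PBE. Qed.
Let PB0 : 0 < PB. Proof. exact: lt_le_trans betaPB. Qed.

(* J controls the evidence from below, and K is the part of the numerator
   where the test accepts the true parameter. *)
Let J w := (\int[Pi]_(f in Ball) (expR (- lr w f))%:E)%E.
Let K w := (\int[Pi]_(f in S) (expR (lr w f) * \1_G w)%:E)%E.

Let mJ : measurable_fun [set: O] J.
Proof.
by apply: (measurable_integral_section_in (h := fun z => expR (- lr z.1 z.2))).
Qed.

Let mKint : measurable_fun [set: O * Th] (fun z => expR (lr z.1 z.2) * \1_G z.1).
Proof.
apply: measurable_funM => //.
by apply: measurableT_comp => //; exact: measurable_indic.
Qed.

Let mK : measurable_fun [set: O] K.
Proof.
apply: (measurable_integral_section_in (h := fun z => expR (lr z.1 z.2) * \1_G z.1)) => //.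
Qed.

(** Markov's inequality; the expectation of J is at most [exp r] times the mass of
    the ball, by Tonelli's theorem. *)
Let evidence_bad : (P [set w | ((PB * expR (2 * r))%:E <= J w)%E] <= (expR (- r))%:E)%E.
Proof.
have p0 : 0 < PB * expR (2 * r) by rewrite mulr_gt0 ?expR_gt0.
apply: le_trans (markov_ge0 P p0 mJ _) _.
  by move=> w; apply: integral_ge0 => f _; rewrite lee_fin expR_ge0.
have EJ : (\int[P]_w J w <= (expR r * PB)%:E)%E.
  apply: le_trans (expectation_integral_le (h := fun z => expR (- lr z.1 z.2))
    (g := fun=> expR r) mBall _ _ _ _ _) _ => //.
  by rewrite integral_cst//= PBE.
apply: le_trans (lee_wpmul2l _ EJ) _; first by rewrite lee_fin invr_ge0 ltW.
rewrite -EFinM lee_fin.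
have -> : 2 * r = r + r by ring.
rewrite expRD expRN le_eqVlt; apply/orP; left; apply/eqP; field.
by rewrite !gt_eqF ?expR_gt0.
Qed.

(** The part of S in the sieve contributes alpha to the expectation of K because
    of the test, and the part outside contributes alpha because the likelihood ratio
    has expectation at most 1 and the prior mass there is small. *)
Let posterior_bad : (P [set w | ((eta * (beta * expR (- (2 * r))))%:E <= K w)%E] <=
  ((eta * (beta * expR (- (2 * r))))^-1 * (2 * alpha))%:E)%E.
Proof.
have p0 : 0 < eta * (beta * expR (- (2 * r))) by rewrite !mulr_gt0 ?expR_gt0.
apply: le_trans (markov_ge0 P p0 mK _) _.
  by move=> w; apply: integral_ge0 => f _; rewrite lee_fin mulr_ge0 ?expR_ge0.
pose U := Pc `\` Sieve.
have mU : measurable U by exact: measurableD.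
pose g f : R := alpha + \1_U f.
have EK : (\int[P]_w K w <= (2 * alpha)%:E)%E.
  have mg : measurable_fun [set: Th] g.
    by apply: measurable_funD => //; exact: measurable_indic.
  apply: le_trans (expectation_integral_le (g := g)
    (h := fun z => expR (lr z.1 z.2) * \1_G z.1) mS _ _ _ _ _) _ => //.
  - by move=> f; rewrite addr_ge0.
  - move=> f Sf /=; have [sf|sf] := pselect (Sieve f).
      by apply: le_trans (tested Sf sf) _; rewrite lee_fin lerDl.
    apply: (@le_trans _ _ 1%E); last first.
      by rewrite lee_fin /g indicE mem_set ?lerDr//; split => //; exact: SPc.
    apply: le_trans (normalized (SPc Sf)); apply: ge0_le_integral => //.
    + apply/measurable_EFinP; exact: (measurableT_comp mKint (measurable_pair2 f)).
    + apply/measurable_EFinP; exact: (measurableT_comp mE (measurable_pair2 f)).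
    + move=> w _; rewrite lee_fin indicE.
      by case: (w \in G); rewrite ?mulr1 ?mulr0 ?expR_ge0.
  - rewrite /g; under eq_integral do rewrite EFinD.
    rewrite ge0_integralD//; last first.
      by apply/measurable_EFinP; apply: measurable_funTS; exact: measurable_indic.
    rewrite integral_cst// integral_indic//.
    rewrite mulr_natl mulr2n EFinD; apply: leeD.
      by rewrite -[leRHS]mule1; apply: lee_wpmul2l; rewrite ?lee_fin// probability_le1.
    apply: le_trans sieve_mass; apply: le_measure; rewrite ?inE//.
    exact: measurableI.
apply: le_trans (lee_wpmul2l _ EK) _; first by rewrite lee_fin invr_ge0 ltW.
by rewrite -EFinM.
Qed.

(** Outside the event where the test rejects and the two events bounded above,
    the evidence relative to the true parameter is at least
    [beta * exp (- (2 r))], and the numerator is smaller than eta times that. *)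
Lemma posterior_tail :
  (P [set w | (eta <= `|post w|)%R] <= P (~` G) + (expR (- r))%:E +
   ((eta * (beta * expR (- (2 * r))))^-1 * (2 * alpha))%:E)%E.
Proof.
pose B1 := [set w | ((PB * expR (2 * r))%:E <= J w)%E].
pose B2 := [set w | ((eta * (beta * expR (- (2 * r))))%:E <= K w)%E].
have mB1 : measurable B1.
  by have := emeasurable_fun_c_infty measurableT mJ (PB * expR (2 * r))%:E; rewrite setTI.
have mB2 : measurable B2.
  have := emeasurable_fun_c_infty measurableT mK
    (eta * (beta * expR (- (2 * r))))%:E.
  by rewrite setTI.
apply: (@le_trans _ _ (P (~` G `|` B1 `|` B2))); last first.
  apply: le_trans (measureU2 _ _ _) _ => //.
    by apply: measurableU => //; exact: measurableC.
  apply: leeD; last exact: posterior_bad.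
  apply: le_trans (measureU2 _ _ _) _ => //; first exact: measurableC.
  by apply: leeD => //; exact: evidence_bad.
apply: le_measure; rewrite ?inE//.
- exact: posterior_event_measurable.
- by apply: measurableU => //; apply: measurableU => //; exact: measurableC.
move=> w /num_den[hAB B0] /=.
have [Gw|] := pselect (G w); last by left; left.
have [hJ|hJ] := leP (PB * expR (2 * r))%:E (J w); first by left; right.
right; rewrite /B2/=.
set A := \int[Pi]_(f in S) (expR (ell (w, f))) in hAB.
set B := \int[Pi]_(f in Pc) (expR (ell (w, f))) in hAB B0.
have fin_of_fine (x : \bar R) : 0 < fine x -> x = (fine x)%:E.
  by case: x => [x //||] /=; rewrite ltxx.
have A0 : 0 < A by apply: lt_le_trans hAB; rewrite mulr_gt0.
have BE : (\int[Pi]_(f in Pc) (expR (ell (w, f)))%:E = B%:E)%E by exact: fin_of_fine.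
have AE : (\int[Pi]_(f in S) (expR (ell (w, f)))%:E = A%:E)%E by exact: fin_of_fine.
pose c := expR (- ell0 w).
have cp : 0 < c by exact: expR_gt0.
have mw D : measurable D -> measurable_fun D (fun f => (expR (ell (w, f)))%:E).
  move=> mD; apply: measurable_funTS; apply/measurable_EFinP; apply: measurableT_comp => //.
  exact: (measurableT_comp mell (measurable_pair1 w)).
have scale D : measurable D -> (\int[Pi]_(f in D) (expR (lr w f))%:E =
    c%:E * \int[Pi]_(f in D) (expR (ell (w, f)))%:E)%E.
  move=> mD; rewrite -ge0_integralZl_EFin ?expR_ge0//; last exact: mw.
  by apply: eq_integral => f _; rewrite -EFinM -expRD addrC.
have -> : K w = (c * A)%:E.
  rewrite /K EFinM -AE -scale//; apply: eq_integral => f _.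
  by rewrite indicE mem_set// mulr1.
pose lam := expR (- (2 * r)).
have lam0 : 0 < lam by exact: expR_gt0.
have lamK : lam * expR (2 * r) = 1 by rewrite -expRD addNr expR0.
have mlrw : measurable_fun [set: Th] (fun f => lr w f).
  exact: (measurableT_comp mlr (measurable_pair1 w)).
have m1 : measurable_fun Ball (fun f => (expR (lr w f))%:E).
  by apply: measurable_funTS; apply/measurable_EFinP; exact: measurableT_comp.
have m2 : measurable_fun Ball (fun f => (expR (- lr w f))%:E).
  apply: measurable_funTS; apply/measurable_EFinP; apply: measurableT_comp => //.
  exact: measurable_funN.
(* Integrate [x >= 2 lam - lam^2 / x], that is [(x - lam)^2 >= 0], for the
   likelihood ratio x over the ball. *)
have low : ((2 * lam * PB)%:E <= (c * B)%:E + (lam * PB)%:E)%E.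
  apply: (@le_trans _ _ (\int[Pi]_(f in Ball) ((expR (lr w f))%:E +
      (lam ^+ 2)%:E * (expR (- lr w f))%:E))%E).
    rewrite EFinM -PBE -integral_cst//; apply: ge0_le_integral => //.
    - by move=> f _; rewrite lee_fin mulr_ge0// ltW.
    - by apply: emeasurable_funD => //; exact: measurable_funeM.
    - move=> f _; rewrite -EFinM -EFinD lee_fin expRN.
      have := expR_gt0 (lr w f); move: (expR _) => x x0.
      rewrite -subr_ge0.
      have -> : x + lam ^+ 2 / x - 2 * lam = (x - lam) ^+ 2 / x.
        by field; rewrite gt_eqF.
      by rewrite divr_ge0 ?sqr_ge0// ltW.
  rewrite ge0_integralD//; last 2 first.
  - by move=> f _; rewrite -EFinM lee_fin mulr_ge0 ?expR_ge0// sqr_ge0.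
  - exact: measurable_funeM.
  apply: leeD.
    rewrite EFinM -BE -scale//; apply: ge0_subset_integral => //.
    by apply: measurable_funTS; apply/measurable_EFinP; exact: measurableT_comp.
  rewrite ge0_integralZl_EFin ?sqr_ge0//.
  apply: le_trans (lee_wpmul2l _ (ltW hJ)) _; first by rewrite lee_fin sqr_ge0.
  rewrite -EFinM lee_fin le_eqVlt; apply/orP; left; apply/eqP.
  have -> : lam ^+ 2 * (PB * expR (2 * r)) = lam * PB * (lam * expR (2 * r)) by ring.
  by rewrite lamK mulr1.
move: low; rewrite -EFinD !lee_fin -/lam => low.
have h1 : lam * PB <= c * B by lra.
apply: (@le_trans _ _ (eta * (c * B))).
  rewrite ler_pM2l//; apply: le_trans h1; rewrite mulrC ler_pM2l//.
by rewrite mulrCA ler_pM2l.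
Qed.

End bayes.

(** * The Gaussian sequence model *)

Section gaussian_sequence_model.
Context (R : realType) (H1 H2 : completeNormedModType R).
Context (ip1 : {dot H1 for idfun}) (ip2 : {dot H2 for idfun}).
Hypothesis norm1E : forall x : H1, `|x| = Num.sqrt (ip1 x x).
Hypothesis norm2E : forall x : H2, `|x| = Num.sqrt (ip2 x x).
Variables (A : {linear H1 -> H2}) (Astar : H2 -> H1).
Hypotheses (hAinj : injective A) (hAcont : continuous A).
Hypothesis hAstar : is_adjoint ip1 ip2 A Astar.
Variables (e : nat -> H1) (rho : nat -> R) (g : nat -> H2).
Hypothesis he : orthonormal_basis ip1 e.
Hypothesis hrho : forall k, Astar (A (e k)) = rho k ^+ 2 *: e k.
Hypothesis hg : forall k, A (e k) = rho k *: g k.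
Variables (Pc : set H1) (B : set (set H1)).
Hypothesis hB : sigma_algebra Pc B.
Hypothesis hBmeas : forall k, measurable_fun (Pc : set (g_sigma_algebraType B))
                (fun f : g_sigma_algebraType B => ip1 f (e k)).
Let Th := g_sigma_algebraType B.

Context d (O : measurableType d) (P : probability O R).
Variables (xi : nat -> O -> R) (subg : subgaussian P xi).
Variables (n : nat) (n0 : (0 < n)%N) (f0 : H1) (Y : H2 -> O -> R).
Hypothesis hY : forall k w,
  Y (g k) w = rho k * ip1 f0 (e k) + (Num.sqrt n%:R)^-1 * xi k w.

Let mxi := subg.1.
Let sn : R := Num.sqrt n%:R.
Let sn0 : 0 < sn. Proof. by rewrite sqrtr_gt0 ltr0n. Qed.
Let sn2 : sn ^+ 2 = n%:R. Proof. by rewrite sqr_sqrtr. Qed.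

Lemma measurable_generated (S : set H1) : B S -> measurable (S : set Th).
Proof. exact: sub_sigma_algebra. Qed.

Lemma measurable_parameter_set : measurable (Pc : set Th).
Proof.
apply: measurable_generated; rewrite -(setD0 Pc).
by case: hB => B0 BD _; exact: BD.
Qed.

(** The coordinates are measurable on Pc only; the extension by 0 is measurable
    everywhere and agrees with them on the support of the prior. *)
Definition restricted_coordinate k (f : Th) : R :=
  if f \in (Pc : set Th) then ip1 f (e k) else 0.

Let F := restricted_coordinate.

Lemma measurable_restricted_coordinate k : measurable_fun [set: Th] (F k).
Proof.
have := (measurable_restrictT (fun f : Th => ip1 f (e k)) measurable_parameter_set).1 (@hBmeas k).
by congr measurable_fun; apply/funext => f; rewrite patchE.
Qed.

Let FE k f : Pc f -> F k f = ip1 f (e k).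
Proof. by move=> Pf; rewrite /F /restricted_coordinate mem_set. Qed.

(** The squared norm of A f is written as a series of coordinates to make the
    joint measurability in the observation and f manifest. *)
Definition log_likelihood (z : O * Th) : R :=
  n%:R * limn (series (fun k => rho k * F k z.2 * Y (g k) z.1)) -
  n%:R / 2 * limn (series (fun k => (rho k * F k z.2) ^+ 2)).

Definition log_likelihood0 (w : O) : R :=
  n%:R * limn (series (fun k => rho k * ip1 f0 (e k) * Y (g k) w)) -
  n%:R / 2 * `|A f0| ^+ 2.

Let mF := measurable_restricted_coordinate.

Let mY k : measurable_fun [set: O] (Y (g k)).
Proof.
rewrite (_ : Y (g k) = fun w => rho k * ip1 f0 (e k) + (Num.sqrt n%:R)^-1 * xi k w).
  by apply: measurable_funD => //; exact: measurable_funM.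
by apply/funext => w; exact: hY.
Qed.

Lemma measurable_log_likelihood : measurable_fun [set: O * Th] log_likelihood.
Proof.
have mF2 k : measurable_fun [set: O * Th] (fun z => F k z.2).
  exact: (measurableT_comp (mF k) measurable_snd).
have mY1 k : measurable_fun [set: O * Th] (fun z => Y (g k) z.1).
  exact: (measurableT_comp (mY k) measurable_fst).
apply: measurable_funB; apply: measurable_funM => //.
- apply: (measurable_lim_series (u := fun k z => rho k * F k z.2 * Y (g k) z.1)) => k.
  by apply: measurable_funM => //; apply: measurable_funM.
- apply: (measurable_lim_series (u := fun k z => (rho k * F k z.2) ^+ 2)) => k.
  by apply: measurable_funX; apply: measurable_funM.
Qed.

Lemma measurable_log_likelihood0 : measurable_fun [set: O] log_likelihood0.
Proof.
apply: measurable_funB => //; apply: measurable_funM => //.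
apply: (measurable_lim_series (u := fun k w => rho k * ip1 f0 (e k) * Y (g k) w)) => k.
exact: measurable_funM.
Qed.

Let image_parseval' f := image_parseval norm1E norm2E hAinj hAcont hAstar he hrho hg (f := f).

Lemma likelihoodE w f : Pc f ->
  likelihood ip1 A e g rho n (fun h => Y h w) f = expR (log_likelihood (w, f)).
Proof.
move=> Pf; rewrite /likelihood /log_likelihood/=.
have -> : (fun k => rho k * F k f * Y (g k) w) = (fun k => rho k * ip1 f (e k) * Y (g k) w).
  by apply/funext => k; rewrite FE.
have -> : (fun k => (rho k * F k f) ^+ 2) = (fun k => (rho k * ip1 f (e k)) ^+ 2).
  by apply/funext => k; rewrite FE.
by rewrite (cvg_lim _ (image_parseval' (f := f))).
Qed.

(** By Parseval's identity the distance to f0 is a measurable function of the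
    coordinates. *)
Lemma measurable_distance_set (S : set R) : measurable S ->
  measurable (Pc `&` [set f | S (`|f - f0| ^+ 2)] : set Th).
Proof.
move=> mS.
pose D (f : Th) := limn (series (fun k => (F k f - ip1 f0 (e k)) ^+ 2)).
have mD : measurable_fun [set: Th] D.
  apply: (measurable_lim_series (u := fun k f => (F k f - ip1 f0 (e k)) ^+ 2)) => k.
  by apply: measurable_funX; exact: measurable_funB.
have DE f : Pc f -> D f = `|f - f0| ^+ 2.
  move=> Pf; rewrite /D.
  have -> : (fun k => (F k f - ip1 f0 (e k)) ^+ 2) = (fun k => ip1 (f - f0) (e k) ^+ 2).
    by apply/funext => k; rewrite FE// linearBl.
  exact: (cvg_lim _ (@parseval _ _ _ norm1E _ he (f - f0))).
rewrite (_ : _ `&` _ = Pc `&` (D @^-1` S)); last first.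
  by apply/seteqP; split => f [Pf h]; split => //; move: h; rewrite /preimage/= DE.
apply: measurableI; first exact: measurable_parameter_set.
by have := mD measurableT S mS; rewrite setTI.
Qed.

Lemma measurable_image_distance_set (S : set R) : measurable S ->
  measurable (Pc `&` [set f | S (`|A f - A f0| ^+ 2)] : set Th).
Proof.
move=> mS.
pose D (f : Th) := limn (series (fun k => (rho k * (F k f - ip1 f0 (e k))) ^+ 2)).
have mD : measurable_fun [set: Th] D.
  apply: (measurable_lim_series (u := fun k f => (rho k * (F k f - ip1 f0 (e k))) ^+ 2)) => k.
  by apply: measurable_funX; apply: measurable_funM => //; exact: measurable_funB.
have DE f : Pc f -> D f = `|A f - A f0| ^+ 2.
  move=> Pf; rewrite /D.
  have -> : (fun k => (rho k * (F k f - ip1 f0 (e k))) ^+ 2) =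
      (fun k => (rho k * ip1 (f - f0) (e k)) ^+ 2).
    by apply/funext => k; rewrite FE// linearBl.
  by rewrite -linearB; exact: (cvg_lim _ (image_parseval' (f := f - f0))).
rewrite (_ : _ `&` _ = Pc `&` (D @^-1` S)); last first.
  by apply/seteqP; split => f [Pf h]; split => //; move: h; rewrite /preimage/= DE.
apply: measurableI; first exact: measurable_parameter_set.
by have := mD measurableT S mS; rewrite setTI.
Qed.

(** Passing from f0 to f moves the mean of the k-th noise coordinate by
    [shift f k]. *)
Definition shift (f : H1) k : R := sn * (rho k * ip1 (f - f0) (e k)).

Lemma shift_norm f : series (fun k => shift f k ^+ 2) @ \oo --> n%:R * `|A (f - f0)| ^+ 2.
Proof.
have -> : series (fun k => shift f k ^+ 2) =
    (fun K => n%:R * series (fun k => (rho k * ip1 (f - f0) (e k)) ^+ 2) K).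
  apply/funext => K; rewrite /series/= mulr_sumr; apply: eq_bigr => k _.
  by rewrite /shift exprMn sn2.
by apply: cvgMr; exact: image_parseval'.
Qed.

(** The two likelihoods contain the series of [rho_k f_k xi_k] and
    [rho_k (f0)_k xi_k], which converge almost surely.  Where both do, the rest is
    algebra: the cross term [sum_k rho_k^2 f_k (f0)_k] is obtained from
    [|A f|^2], [|A f0|^2] and [|A (f - f0)|^2] by polarization. *)
Lemma log_likelihood_ratio_ae f : Pc f ->
  {ae P, forall w, log_likelihood (w, f) - log_likelihood0 w =
    limn (series (fun k => shift f k * xi k w)) - n%:R * `|A (f - f0)| ^+ 2 / 2}.
Proof.
move=> Pf.
have cf h : cvgn (series (fun k => (rho k * ip1 h (e k)) ^+ 2)).
  by apply/cvg_ex; exists (`|A h| ^+ 2); exact: image_parseval'.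
have [Nf [mNf Nf0 hNf]] := subgaussian_series_cvg subg (cf f).
have [N0 [mN0 N00 hN0]] := subgaussian_series_cvg subg (cf f0).
exists (Nf `|` N0); split; first exact: measurableU.
  by rewrite measureU0.
move=> w /= hw.
have [cfw|ncfw] := pselect (cvgn (series (fun k => rho k * ip1 f (e k) * xi k w))); last first.
  by left; exact: hNf.
have [c0w|nc0w] := pselect (cvgn (series (fun k => rho k * ip1 f0 (e k) * xi k w))); last first.
  by right; exact: hN0.
exfalso; apply: hw.
set Lf := limn (series (fun k => rho k * ip1 f (e k) * xi k w)) in cfw.
set L0 := limn (series (fun k => rho k * ip1 f0 (e k) * xi k w)) in c0w.
have ef := image_parseval' (f := f).
have e0 := image_parseval' (f := f0).
have ed := image_parseval' (f := f - f0).
pose I := (`|A f| ^+ 2 + `|A f0| ^+ 2 - `|A (f - f0)| ^+ 2) / 2.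
have -> : limn (series (fun k => shift f k * xi k w)) = sn * (Lf - L0).
  apply: cvg_lim => //.
  have -> : series (fun k => shift f k * xi k w) = (fun K => sn *
     (series (fun k => rho k * ip1 f (e k) * xi k w) K -
      series (fun k => rho k * ip1 f0 (e k) * xi k w) K)).
    apply/funext => K; rewrite /series/= -sumrB mulr_sumr; apply: eq_bigr => k _.
    by rewrite /shift linearBl/=; ring.
  by apply: cvgMr; exact: cvgB.
rewrite /log_likelihood /log_likelihood0/=.
have -> : (fun k => rho k * F k f * Y (g k) w) = (fun k => rho k * ip1 f (e k) * Y (g k) w).
  by apply/funext => k; rewrite FE.
have -> : (fun k => (rho k * F k f) ^+ 2) = (fun k => (rho k * ip1 f (e k)) ^+ 2).
  by apply/funext => k; rewrite FE.
have -> : limn (series (fun k => rho k * ip1 f (e k) * Y (g k) w)) = I + sn^-1 * Lf.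
  apply: cvg_lim => //.
  have -> : series (fun k => rho k * ip1 f (e k) * Y (g k) w) = (fun K =>
     (series (fun k => (rho k * ip1 f (e k)) ^+ 2) K +
      series (fun k => (rho k * ip1 f0 (e k)) ^+ 2) K -
      series (fun k => (rho k * ip1 (f - f0) (e k)) ^+ 2) K) / 2 +
     sn^-1 * series (fun k => rho k * ip1 f (e k) * xi k w) K).
    apply/funext => K; rewrite /series/= -big_split/= -sumrB mulr_suml mulr_sumr -big_split/=.
    by apply: eq_bigr => k _; rewrite hY (linearBl ip1)/= -/sn; field; rewrite gt_eqF.
  apply: cvgD; last exact: cvgMr.
  by apply: cvgMl; apply: cvgB => //; exact: cvgD.
have -> : limn (series (fun k => rho k * ip1 f0 (e k) * Y (g k) w)) =
    `|A f0| ^+ 2 + sn^-1 * L0.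
  apply: cvg_lim => //.
  have -> : series (fun k => rho k * ip1 f0 (e k) * Y (g k) w) = (fun K =>
      series (fun k => (rho k * ip1 f0 (e k)) ^+ 2) K +
     sn^-1 * series (fun k => rho k * ip1 f0 (e k) * xi k w) K).
    apply/funext => K; rewrite /series/= mulr_sumr -big_split/=.
    by apply: eq_bigr => k _; rewrite hY -/sn; ring.
  by apply: cvgD => //; exact: cvgMr.
rewrite (cvg_lim _ ef)// /I -sn2; field.
by rewrite gt_eqF.
Qed.

Let lr f w := log_likelihood (w, f) - log_likelihood0 w.
Let V f := n%:R * `|A (f - f0)| ^+ 2.
Let ls f w := limn (series (fun k => shift f k * xi k w)) - V f / 2.

Let mlr f : measurable_fun [set: O] (lr f).
Proof.
apply: measurable_funB; last exact: measurable_log_likelihood0.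
exact: (measurableT_comp measurable_log_likelihood (measurable_pair2 f)).
Qed.

Let mls f : measurable_fun [set: O] (ls f).
Proof. by apply: measurable_funB => //; exact: (measurable_series_lim subg). Qed.

Lemma expectation_likelihood_ratio (f : H1) (Phi : R -> R) (h : O -> R) : Pc f ->
  measurable_fun [set: R] Phi -> (forall x, 0 <= Phi x) ->
  measurable_fun [set: O] h -> (forall w, 0 <= h w) ->
  (\int[P]_w (Phi (lr f w) * h w)%:E = \int[P]_w (Phi (ls f w) * h w)%:E)%E.
Proof.
move=> Pf mPhi Phi0 mh h0.
apply: ge0_ae_eq_integral => //.
- apply/measurable_EFinP; apply: measurable_funM => //.
  exact: (measurableT_comp mPhi (mlr f)).
- apply/measurable_EFinP; apply: measurable_funM => //.
  exact: (measurableT_comp mPhi (mls f)).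
- by move=> w _; rewrite lee_fin mulr_ge0.
- by move=> w _; rewrite lee_fin mulr_ge0.
- have [N [mN N0 hN]] := log_likelihood_ratio_ae Pf.
  exists N; split => // w /= nh; apply: hN => /= hw; apply: nh => _.
  by rewrite /lr hw.
Qed.

Lemma likelihood_ratio_normalized f : Pc f -> (\int[P]_w (expR (lr f w))%:E <= 1)%E.
Proof.
move=> Pf; apply: le_trans (tilted_expR_le subg (shift_norm (f := f))).
rewrite le_eqVlt; apply/orP; left; apply/eqP.
transitivity (\int[P]_w (expR (lr f w) * 1)%:E)%E.
  by apply: eq_integral => w _; rewrite mulr1.
rewrite expectation_likelihood_ratio//.
by apply: eq_integral => w _; rewrite mulr1.
Qed.

(** Since [- (S - V / 2) = (- S - V / 2) + V], this is the bound of the tilted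
    expectation for [- shift f], times [exp V]. *)
Lemma inverse_likelihood_ratio_le f : Pc f ->
  (\int[P]_w (expR (- lr f w))%:E <= (expR (V f))%:E)%E.
Proof.
move=> Pf.
have cN : series (fun k => (- shift f k) ^+ 2) @ \oo --> V f.
  under eq_fun do rewrite sqrrN; exact: shift_norm.
have := tilted_expR_le subg cN => hN.
have Vp : (0 <= (expR (V f))%:E)%E by rewrite lee_fin expR_ge0.
have := lee_wpmul2l Vp hN; rewrite mule1; apply: le_trans.
rewrite -ge0_integralZl_EFin ?expR_ge0//; last first.
  apply/measurable_EFinP; apply: measurableT_comp => //; apply: measurable_funB => //.
  exact: (measurable_series_lim subg (fun l => - shift f l)).
rewrite le_eqVlt; apply/orP; left; apply/eqP.
transitivity (\int[P]_w (expR (- lr f w) * 1)%:E)%E.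
  by apply: eq_integral => w _; rewrite mulr1.
rewrite (@expectation_likelihood_ratio f (fun x => expR (- x)))//; last first.
  by apply: measurableT_comp => //; exact: oppr_measurable.
have [N [mN N0 hN']] := @subgaussian_series_cvg _ _ _ _ _ subg (shift f)
  ((cvg_ex _).2 (ex_intro _ (V f) (shift_norm (f := f)))).
have mlsN : measurable_fun [set: O] (fun w =>
    expR (limn (series (fun l => - shift f l * xi l w)) - V f / 2)).
  apply: measurableT_comp => //; apply: measurable_funB => //.
  exact: (measurable_series_lim subg (fun l => - shift f l)).
apply: ge0_ae_eq_integral => //.
- apply/measurable_EFinP; apply: measurable_funM => //.
  by apply: measurableT_comp => //; exact: measurable_funN.
- by apply: measurable_funeM; exact/measurable_EFinP.
- exists N; split => // w /= nh; apply: hN' => /= cw; apply: nh => _.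
  rewrite mulr1 -EFinM -expRD; congr (expR _)%:E; rewrite /ls.
  have -> : limn (series (fun l => - shift f l * xi l w)) =
      - limn (series (fun l => shift f l * xi l w)).
    apply: cvg_lim => //.
    have -> : series (fun l => - shift f l * xi l w) =
        - series (fun l => shift f l * xi l w).
      apply/funext => K; rewrite /series/= fctE -sumrN.
      by apply: eq_bigr => l _; rewrite mulNr.
    exact: cvgN.
  by field.
Qed.

Variable phi : nat -> H1.
Hypothesis hphi : orthonormal_basis ip1 phi.
Hypothesis hphi_fin : forall k, finite_set [set l | `|ip1 (phi k) (e l)| != 0].
Variables (k : nat) (k0 : (0 < k)%N) (N : nat).
Hypothesis hN : forall m l, (m < k)%N -> (N <= l)%N -> ip1 (phi m) (e l) = 0.

Let de := delta_inf ip1 phi e rho k.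
Let th := de / Num.sqrt 2.
Let th2 : th ^+ 2 = de ^+ 2 / 2.
Proof. by rewrite /th expr_div_n sqr_sqrtr. Qed.

Let rho_neq0 := singular_value_neq0 hAinj he hg.

(** Row m of the matrix which maps the noise to the first k phi-coordinates of the
    inverted data, scaled so as to be a contraction. *)
Definition test_vector m l : R := th * (ip1 (phi m) (e l) / rho l).

Definition test_statistic w : R :=
  (\sum_(0 <= m < k) (\sum_(0 <= l < N) test_vector m l * xi l w) ^+ 2) / 2.

Let contract (c : nat -> R) :
  \sum_(0 <= l < N) (\sum_(0 <= m < k) c m * test_vector m l) ^+ 2 <=
  (\sum_(0 <= m < k) c m ^+ 2) / 2.
Proof.
exact: (test_vectors_contract norm1E hAinj he hg hphi hphi_fin c k0 hN th2).
Qed.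

Lemma measurable_test_statistic : measurable_fun [set: O] test_statistic.
Proof.
apply: measurable_funM => //; apply: measurable_sum => m; apply: measurable_funX.
by apply: measurable_sum => l; exact: measurable_funM.
Qed.

Lemma test_mgf : (\int[P]_w (expR (test_statistic w))%:E <= (Num.sqrt 2 ^+ k)%:E)%E.
Proof.
have c0 : series (fun l => (0 : R) ^+ 2) @ \oo --> (0 : R).
  have -> : series (fun l => (0 : R) ^+ 2) = fun=> 0.
    by apply/funext => K; rewrite /series/= big1// => i _; rewrite expr0n.
  exact: cvg_cst.
apply: le_trans (tilted_expR_square_le subg c0 contract).
rewrite le_eqVlt; apply/orP; left; apply/eqP; apply: eq_integral => w _.
have -> : series (fun l => 0 * xi l w) = fun=> 0.
  by apply/funext => K; rewrite /series/= big1// => i _; rewrite mul0r.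
rewrite lim_cst// mul0r subrr expR0 mul1r /test_statistic.
congr (expR (_ / 2))%:E; apply: eq_bigr => m _; congr (_ ^+ 2).
by rewrite [X in _ - X]big1 ?subr0// => l _; rewrite mulr0.
Qed.

(** Squares of k coordinates cost [sqrt 2 ^+ k], which the dimension condition
    turns into [exp a]. *)
Lemma sqrt2_pow_le (a : R) : k%:R <= a -> Num.sqrt 2 ^+ k <= expR a.
Proof.
move=> ka; apply: (@le_trans _ _ (expR k%:R)); last by rewrite ler_expR.
rewrite -[k%:R]mulr1 expRM_natl lerXn2r ?nnegrE ?sqrtr_ge0 ?expR_ge0//.
apply: (@le_trans _ _ 2); last by apply: le_trans (expR_ge1Dx _).
rewrite -[leRHS]ger0_norm// -sqrtr_sqr ler_sqrt ?sqr_ge0//.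
by rewrite expr2 ler_peMr// ler1n.
Qed.

Lemma test_error_null (a b : R) : k%:R <= a ->
  (P [set w | (a + b <= test_statistic w)%R] <= (expR (- b))%:E)%E.
Proof.
move=> ka.
have mT : measurable_fun [set: O] (fun w => (expR (test_statistic w))%:E).
  by apply/measurable_EFinP; apply: measurableT_comp => //; exact: measurable_test_statistic.
have -> : [set w | a + b <= test_statistic w] =
    [set w | ((expR (a + b))%:E <= (expR (test_statistic w))%:E)%E].
  by apply/seteqP; split => w /=; rewrite lee_fin ler_expR.
apply: le_trans (markov_ge0 P (expR_gt0 _) mT _) _.
  by move=> w; rewrite lee_fin expR_ge0.
have ei : (0 <= (expR (a + b))^-1%:E)%E by rewrite lee_fin invr_ge0 expR_ge0.
apply: le_trans (lee_wpmul2l ei test_mgf) _.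
rewrite -EFinM lee_fin -expRN.
apply: (@le_trans _ _ (expR (- (a + b)) * expR a)).
  by rewrite ler_wpM2l ?expR_ge0// sqrt2_pow_le.
by rewrite -expRD ler_expR; lra.
Qed.

(** Under f the inverted data have mean f, so the statistic is shifted by the
    phi-coordinates of f - f0. *)
Lemma test_mean f m : (m < k)%N ->
  \sum_(0 <= l < N) test_vector m l * shift f l = th * sn * ip1 (f - f0) (phi m).
Proof.
move=> mk; rewrite [in RHS](@finite_expansion _ _ _ norm1E _ he (phi m) N); last first.
  by move=> l; exact: hN.
rewrite ipC ip_suml mulr_sumr; apply: eq_bigr => l _.
rewrite /test_vector /shift (ipC ip1 (e l)); field.
exact: rho_neq0.
Qed.

(** If the statistic is small although its mean is large, then the centered
    statistic is large, as [x^2 <= 2 (X - x)^2 + 2 X^2]; under f its exponential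
    moment is at most [sqrt 2 ^+ k]. *)
Lemma test_error_alternative f (a b s : R) : Pc f -> k%:R <= a ->
  b + s <= (\sum_(0 <= m < k) (th * sn * ip1 (f - f0) (phi m)) ^+ 2) / 4 ->
  (\int[P]_w (expR (lr f w) * \1_([set w | (test_statistic w < b)%R]) w)%:E <=
   (expR (a - s))%:E)%E.
Proof.
move=> Pf ka hs.
set G := [set w | _].
have mG : measurable G.
  have := measurable_fun_ltr measurable_test_statistic (measurable_cst b).
  by move=> /(_ measurableT [set true] Logic.I); rewrite setTI.
rewrite (expectation_likelihood_ratio (Phi := expR) Pf)//.
pose X m w := \sum_(0 <= l < N) test_vector m l * xi l w.
pose x m := \sum_(0 <= l < N) test_vector m l * shift f l.
have mX m : measurable_fun [set: O] (X m).
  by apply: measurable_sum => l; exact: measurable_funM.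
have mZ : measurable_fun [set: O] (fun w => expR (ls f w) *
    expR ((\sum_(0 <= m < k) (X m w - x m) ^+ 2) / 2)).
  apply: measurable_funM; first exact: measurableT_comp.
  apply: measurableT_comp => //; apply: measurable_funM => //.
  by apply: measurable_sum => m; apply: measurable_funX; exact: measurable_funB.
apply: (@le_trans _ _ ((expR (- s))%:E * \int[P]_w (expR (ls f w) *
    expR ((\sum_(0 <= m < k) (X m w - x m) ^+ 2) / 2))%:E)%E); last first.
  have es : (0 <= (expR (- s))%:E)%E by rewrite lee_fin expR_ge0.
  apply: le_trans (lee_wpmul2l es (tilted_expR_square_le subg (shift_norm (f := f)) contract)) _.
  rewrite -EFinM lee_fin addrC expRD ler_wpM2l ?expR_ge0//.
  exact: sqrt2_pow_le.
rewrite -ge0_integralZl_EFin ?expR_ge0//; last exact/measurable_EFinP.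
apply: ge0_le_integral => //.
- apply/measurable_EFinP; apply: measurable_funM; first exact: measurableT_comp.
  exact: measurable_indic.
- by apply: measurable_funeM; exact/measurable_EFinP.
move=> w _; rewrite -EFinM lee_fin indicE.
have [wG|wG] := boolP (w \in G); last by rewrite mulr0 !mulr_ge0 ?expR_ge0.
rewrite mulr1 mulrCA -[leLHS]mulr1 ler_wpM2l ?expR_ge0// -expRD.
rewrite -[leLHS]expR0 ler_expR.
have {wG} : test_statistic w < b by rewrite inE in wG.
rewrite /test_statistic -/(X _ _) => Tb.
have xE : \sum_(0 <= m < k) x m ^+ 2 =
    \sum_(0 <= m < k) (th * sn * ip1 (f - f0) (phi m)) ^+ 2.
  by apply: eq_big_nat => m /andP[_ mk]; rewrite /x test_mean.
have : \sum_(0 <= m < k) x m ^+ 2 <=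
    2 * \sum_(0 <= m < k) (X m w - x m) ^+ 2 + 2 * \sum_(0 <= m < k) X m w ^+ 2.
  rewrite !mulr_sumr -big_split/=; apply: ler_sum => m _.
  by have := sqr_ge0 (2 * X m w - x m); nra.
rewrite xE; move: hs Tb; rewrite /X.
move: (\sum_(0 <= m < k) (th * _ * _) ^+ 2) => S1.
move: (\sum_(0 <= m < k) (\sum_(0 <= l < N) _) ^+ 2) => S2.
move: (\sum_(0 <= m < k) _) => S3.
lra.
Qed.

Variables (Q : H1 -> H1) (Pi : probability Th R) (Sieve : set H1).
Hypothesis hQ : is_orthogonal_projection ip1 (lin_span phi k) Q.
Variables (eps rate c C C1 C2 C3 eta : R).
Hypotheses (eps0 : 0 < eps) (rate0 : 0 < rate) (c_gt0 : 0 < c) (C_gt0 : 0 < C)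
  (C1_gt0 : 0 < C1) (C2_gt0 : 0 < C2) (C3_gt0 : 0 < C3) (eta0 : 0 < eta).
Hypothesis hk : k%:R <= c * n%:R * eps ^+ 2.
Hypothesis hdelta : eps / de <= C1 * rate.
Hypothesis mSieve : B Sieve.
Hypothesis hSieve : Sieve `<=` [set f | Pc f /\ `|Q f - f| <= C2 * rate].
Hypothesis hf0 : `|Q f0 - f0| <= C3 * rate.
Hypothesis sieve_mass :
  (Pi (Pc `\` Sieve) <= (expR (- (C + 4) * n%:R * eps ^+ 2))%:E)%E.
Hypothesis ball_mass :
  ((expR (- C * n%:R * eps ^+ 2))%:E <=
    Pi [set f | Pc f /\ (`|A f - A f0| <= eps)%R])%E.

(** The terms C2 and C3 pay for the projections of f and f0.  The remainder is
    [1 + t] with t proportional to the exponent [C + 5 + 2 c] of the two test errors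
    together; it enters squared, and [(1 + t)^2 >= t]. *)
Definition contraction_constant : R :=
  C2 + C3 + (1 + 8 * C1 ^+ 2 * (C + 5 + 2 * c)).

Let M := contraction_constant.
Let r : R := n%:R * eps ^+ 2.

(** The projections of f and f0 are [(1 + t) * rate] apart by the triangle
    inequality, and [eps <= C1 * rate * de] converts this distance to the
    scale [n eps^2]. *)
Let separated f : Sieve f -> M * rate <= `|f - f0| ->
  (c + 1) * r + (C + 4 + c) * r <=
  (\sum_(0 <= m < k) (th * sn * ip1 (f - f0) (phi m)) ^+ 2) / 4.
Proof.
move=> /hSieve[Pf fQ] fM.
have de0 : 0 < de by exact: (delta_inf_gt0 norm1E hAinj he hg hphi hphi_fin k0).
pose D := `|Q f - Q f0|.
have -> : \sum_(0 <= m < k) (th * sn * ip1 (f - f0) (phi m)) ^+ 2 =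
    de ^+ 2 / 2 * n%:R * D ^+ 2.
  rewrite /D (projection_dist_sqr norm1E hphi f f0 hQ) mulr_sumr.
  by apply: eq_bigr => m _; rewrite exprMn (exprMn _ th) th2 sn2.
pose t := 8 * C1 ^+ 2 * (C + 5 + 2 * c).
have t0 : 0 < t.
  have aux : 0 < C + 5 + 2 * c by rewrite !addr_gt0 // mulr_gt0.
  by rewrite /t mulr_gt0// mulr_gt0// exprn_gt0.
have DM : (1 + t) * rate <= D.
  have : `|f - f0| <= `|Q f - f| + D + `|Q f0 - f0|.
    have -> : f - f0 = (f - Q f) + (Q f - Q f0) + (Q f0 - f0).
      by rewrite !addrA subrK subrK.
    rewrite (distrC (Q f) f); apply: le_trans (ler_normD _ _) _.
    by rewrite lerD2r ler_normD.
  move: fM fQ hf0; rewrite /M /contraction_constant -/t -/D.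
  move: (`|f - f0|) (`|Q f - f|) (`|Q f0 - f0|) D => x y z D'.
  rewrite !(mulrDl _ _ rate) mul1r.
  move: (C2 * rate) (C3 * rate) (t * rate) => u v v'; lra.
have de_eps : eps <= C1 * rate * de by rewrite -ler_pdivrMr.
have tD : (1 + t) * eps <= C1 * (D * de).
  apply: (@le_trans _ _ ((1 + t) * (C1 * rate * de))).
    by rewrite ler_pM2l// addr_gt0.
  have -> : (1 + t) * (C1 * rate * de) = C1 * ((1 + t) * rate * de) by ring.
  by rewrite ler_pM2l// ler_pM2r.
have tD2 : (1 + t) ^+ 2 * eps ^+ 2 <= C1 ^+ 2 * (D * de) ^+ 2.
  rewrite -!exprMn; apply: lerXn2r tD; rewrite nnegrE.
    by apply: mulr_ge0; [apply: addr_ge0 => //; exact: ltW|exact: ltW].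
  by apply: mulr_ge0; [exact: ltW|apply: mulr_ge0; [exact: normr_ge0|exact: ltW]].
have tt : t * eps ^+ 2 <= C1 ^+ 2 * (D * de) ^+ 2.
  apply: le_trans tD2; rewrite ler_wpM2r ?sqr_ge0//.
  have := sqr_ge0 t; rewrite sqrrD expr1n mul1r; lra.
have n0' : 0 < n%:R :> R by rewrite ltr0n.
have C12 : 0 < C1 ^+ 2 by rewrite exprn_gt0.
have key : 8 * (C + 5 + 2 * c) * eps ^+ 2 <= (D * de) ^+ 2.
  rewrite -(ler_pM2l C12); apply: le_trans tt.
  by rewrite /t le_eqVlt; apply/orP; left; apply/eqP; ring.
have -> : (c + 1) * r + (C + 4 + c) * r =
    n%:R * (8 * (C + 5 + 2 * c) * eps ^+ 2) / 8 by rewrite /r; field.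
have -> : de ^+ 2 / 2 * n%:R * D ^+ 2 / 4 = n%:R * (D * de) ^+ 2 / 8 by field.
by rewrite ler_pM2r// ler_pM2l.
Qed.

(** The test threshold [(c + 1) r] gives the error [exp (- r)] under f0, where c r
    covers the dimension; the signal then leaves the exponent [(C + 4) r] for
    the error under f, which beats the lower bound [exp (- (C + 2) r)] of the
    evidence. *)
Lemma posterior_deviation :
  (P [set w | (eta <= `|posterior ip1 A e g rho Pc Pi n (fun h => Y h w)
         [set f | Pc f /\ (M * rate <= `|f - f0|)%R] - 0|)%R]
    <= ((2 + 2 / eta) * expR (- r))%:E)%E.
Proof.
have M0 : 0 < M.
  have aux : 0 < C + 5 + 2 * c by rewrite !addr_gt0 // mulr_gt0.
  apply: addr_gt0; first exact: addr_gt0.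
  by apply: addr_gt0 => //; rewrite mulr_gt0// mulr_gt0// exprn_gt0.
set S : set Th := [set f | Pc f /\ M * rate <= `|f - f0|].
pose Ball : set Th := [set f | Pc f /\ `|A f - A f0| <= eps].
have mS : measurable S.
  have -> : S = Pc `&` [set f | [set x : R | (M * rate) ^+ 2 <= x] (`|f - f0| ^+ 2)].
    apply/seteqP; split => f [Pf h]; split => //; move: h => /=.
      by move=> h; rewrite lerXn2r// nnegrE ?mulr_ge0// ltW.
    by rewrite ler_pXn2r// nnegrE ?mulr_ge0// ltW.
  apply: measurable_distance_set.
  by rewrite -set_itvcy; exact: measurable_itv.
have mBall : measurable Ball.
  have -> : Ball = Pc `&` [set f | [set x : R | x <= eps ^+ 2] (`|A f - A f0| ^+ 2)].
    apply/seteqP; split => f [Pf h]; split => //; move: h => /=.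
      by move=> h; rewrite lerXn2r// nnegrE// ltW.
    by rewrite ler_pXn2r// nnegrE// ltW.
  apply: measurable_image_distance_set.
  by rewrite -set_itvNyc; exact: measurable_itv.
have mSv : measurable (Sieve : set Th) by exact: measurable_generated.
have kr : k%:R <= c * r by rewrite /r mulrA.
pose G := [set w | test_statistic w < (c + 1) * r].
have mG : measurable G.
  have := measurable_fun_ltr measurable_test_statistic (measurable_cst ((c + 1) * r)).
  by move=> /(_ measurableT [set true] Logic.I); rewrite setTI.
have PG : (P (~` G) <= (expR (- r))%:E)%E.
  have -> : ~` G = [set w | c * r + r <= test_statistic w].
    by apply/seteqP; split => w /=; rewrite /G/= mulrDl mul1r leNgt => /negP.
  exact: test_error_null.
have likE (D : set Th) w : D `<=` (Pc : set Th) ->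
    \int[Pi]_(f in D) likelihood ip1 A e g rho n (fun h => Y h w) f =
    \int[Pi]_(f in D) expR (log_likelihood (w, f)).
  by move=> DPc; apply: eq_Rintegral => f; rewrite inE => /DPc; exact: likelihoodE.
have SPc : S `<=` (Pc : set Th) by move=> f [].
have BallPc : Ball `<=` (Pc : set Th) by move=> f [].
have postE w : posterior ip1 A e g rho Pc Pi n (fun h => Y h w) S =
    (\int[Pi]_(f in S) expR (log_likelihood (w, f))) /
    (\int[Pi]_(f in (Pc : set Th)) expR (log_likelihood (w, f))).
  by congr (_ / _); [exact: likE|exact: likE].
have -> : [set w | eta <= `|posterior ip1 A e g rho Pc Pi n (fun h => Y h w) S - 0| ] =
   [set w | eta <= `|(\int[Pi]_(f in S) expR (log_likelihood (w, f))) /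
     (\int[Pi]_(f in (Pc : set Th)) expR (log_likelihood (w, f)))| ].
  by apply/funext => w; rewrite /mkset subr0 postE.
apply: le_trans (posterior_tail (P := P) (Pi := Pi)
  measurable_log_likelihood measurable_log_likelihood0
  measurable_parameter_set mS mBall mSv mG SPc BallPc (r := r)
  (alpha := expR (- (C + 4) * r)) (beta := expR (- C * r)) _ eta0 _ _ _ _ _ _) _.
- exact: expR_gt0.
- exact: expR_ge0.
- by move=> f Pf; exact: likelihood_ratio_normalized.
- move=> f [Pf fM] Sf.
  have h := test_error_alternative Pf kr (separated Sf fM).
  apply: (le_trans h); rewrite lee_fin ler_expR; lra.
- move=> f [Pf fA]; apply: le_trans (inverse_likelihood_ratio_le Pf) _.
  rewrite lee_fin ler_expR /V /r linearB; apply: ler_wpM2l => //.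
  by apply: lerXn2r => //; rewrite nnegrE//; exact: ltW.
- by rewrite /r mulrA.
- by rewrite /r mulrA.
apply: (@le_trans _ _ ((expR (- r))%:E + (expR (- r))%:E +
   ((eta * (expR (- C * r) * expR (- (2 * r))))^-1 * (2 * expR (- (C + 4) * r)))%:E)%E).
  by apply: leeD => //; exact: leeD.
rewrite -!EFinD lee_fin [leRHS]mulrDl; apply: lerD; first by rewrite mulr_natl mulr2n.
rewrite -expRD invfM -expRN.
have -> : eta^-1 * expR (- (- C * r + - (2 * r))) * (2 * expR (- (C + 4) * r)) =
    2 / eta * (expR (- (- C * r + - (2 * r))) * expR (- (C + 4) * r)) by ring.
rewrite -expRD; apply: ler_wpM2l; first by rewrite divr_ge0// ltW.
rewrite ler_expR.
have r0 : 0 <= r by rewrite mulr_ge0// sqr_ge0.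
lra.
Qed.

End gaussian_sequence_model.

(** * Contraction *)

Theorem theorem2p1 (R : realType)
    (H1 H2 : completeNormedModType R)
    (ip1 : {dot H1 for idfun}) (ip2 : {dot H2 for idfun})
    (hH1 : separable_hilbert ip1) (hH2 : separable_hilbert ip2)
    (A : {linear H1 -> H2}) (hAinj : injective A) (hAcont : continuous A)
    (Astar : H2 -> H1) (hAstar : is_adjoint ip1 ip2 A Astar)
    (e : nat -> H1) (he : orthonormal_basis ip1 e)
    (rho : nat -> R) (hrho : forall k, Astar (A (e k)) = rho k ^+ 2 *: e k)
    (g : nat -> H2) (hg : forall k, A (e k) = rho k *: g k)
    (phi : nat -> H1) (hphi : orthonormal_basis ip1 phi)
    (hphi_fin : forall k, finite_set [set l | `|ip1 (phi k) (e l)| != 0])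
    (Proj : nat -> H1 -> H1)
    (hProj : forall m, is_orthogonal_projection ip1 (lin_span phi m) (Proj m))
    (Pc : set H1) (B : set (set H1)) (hB : sigma_algebra Pc B)
    (hBsub : forall S, B S -> S `<=` Pc)
    (hBmeas : forall k, measurable_fun (Pc : set (g_sigma_algebraType B))
                (fun f : g_sigma_algebraType B => ip1 f (e k)))
    (Pi : nat -> probability (g_sigma_algebraType B) R)
    (hPi : forall n, Pi n Pc = 1%E)
    (eps xi : nat -> R) (kn : nat -> nat)
    (heps : forall n, (0 < n)%N -> 0 < eps n)
    (hxi : forall n, (0 < n)%N -> 0 < xi n)
    (hkn : forall n, (0 < n)%N -> (0 < kn n)%N)
    (heps0 : eps n @[n --> \oo] --> (0 : R))
    (hxi0 : xi n @[n --> \oo] --> (0 : R))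
    (hkn_oo : kn n @[n --> \oo] --> \oo)
    (hneps : Num.sqrt n%:R * eps n @[n --> \oo] --> +oo)
    (c C1 : R) (hc : 0 < c) (hC1 : 0 < C1)
    (hkn_le : forall n, (0 < n)%N -> (kn n)%:R <= c * n%:R * eps n ^+ 2)
    (hdelta : forall n, (0 < n)%N ->
       eps n / delta_inf ip1 phi e rho (kn n) <= C1 * xi n)
    (C2 : R) (hC2 : 0 < C2)
    (Pn : nat -> set H1)
    (hPn_meas : forall n, (0 < n)%N -> B (Pn n))
    (hPn : forall n, (0 < n)%N ->
       Pn n `<=` [set f | Pc f /\ `|Proj (kn n) f - f| <= C2 * xi n])
    (f0 : H1)
    (C : R) (hC : 0 < C)
    (hsieve : \forall n \near \oo,
       (Pi n (Pc `\` Pn n) <= (expR (- (C + 4) * n%:R * eps n ^+ 2))%:E)%E)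
    (hball : \forall n \near \oo,
       ((expR (- C * n%:R * eps n ^+ 2))%:E <=
         Pi n [set f | Pc f /\ (`|A f - A f0| <= eps n)%R])%E)
    (hf0 : (fun n => `|Proj (kn n) f0 - f0|) =O_\oo xi)
    (d : nat -> measure_display) (Omega : forall n, measurableType (d n))
    (P : forall n, probability (Omega n) R)
    (Y : forall n, H2 -> {RV (P n) >-> R})
    (hY : forall n, (0 < n)%N -> has_law ip2 A f0 n (Y n)) :
  exists M : R,
    cvg_in_probability P
      (fun n (w : Omega n) =>
         posterior ip1 A e g rho Pc (Pi n) n (fun h => Y n h w)
           [set f | Pc f /\ M * xi n <= `|f - f0|])
      0.
Proof.
have [norm1E _] := hH1; have [norm2E _] := hH2.
have [C3 C3_gt0 hC3] := (eqO_exP _ _ _).1 hf0.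
exists (contraction_constant c C C1 C2 C3) => eta eta0.
pose r n : R := n%:R * eps n ^+ 2.
have r_oo : r n @[n --> \oo] --> +oo.
  apply: (ger_cvgy _ hneps).
  have h1 : \forall n \near \oo, 1 <= Num.sqrt n%:R * eps n.
    by move/cvgryPge : hneps => /(_ 1).
  near=> n; have n1 : 1 <= Num.sqrt n%:R * eps n by near: n.
  have -> : r n = (Num.sqrt n%:R * eps n) ^+ 2 by rewrite exprMn sqr_sqrtr.
  by rewrite expr2 ler_peMr// (le_trans ler01).
have bound_cvg : ((2 + 2 / eta) * expR (- r n))%:E @[n --> \oo] --> 0%E.
  apply: cvg_EFin; first by near=> n.
  rewrite -(mulr0 (2 + 2 / eta)); apply: cvgMr.
  exact: (cvg_comp _ _ r_oo (@cvgr_expR R)).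
apply: (squeeze_cvge _ (cvg_cst 0%E) bound_cvg).
near=> n; rewrite measure_ge0 /=.
have n0 : (0 < n)%N by near: n; exists 1%N.
have [Z [hZ hYZ]] := hY n n0.
have orth_g := conjugate_orthonormal hAinj hAstar he hrho hg.
have subg := white_noise_subgaussian hZ orth_g.
have [N hN] := active_indices_bounded hphi_fin (kn n).
have hYk k w : Y n (g k) w =
    rho k * ip1 f0 (e k) + (Num.sqrt n%:R)^-1 * Z (g k) w.
  by rewrite hYZ (ip_image_singular hAinj hAstar he hrho hg).
apply: (posterior_deviation norm1E norm2E hAinj hAcont hAstar he hrho hg hB
  hBmeas subg n0 hYk hphi hphi_fin (hkn n n0) hN (hProj (kn n)) (heps n n0)
  (hxi n n0) hc hC hC1 hC2 C3_gt0 eta0 (hkn_le n n0) (hdelta n n0)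
  (hPn_meas n n0) (hPn n n0)).
- rewrite -[X in C3 * X](ger0_norm (ltW (hxi n n0))) -[leLHS]normr_id.
  by near: n; exact: hC3.
- by near: n; exact: hsieve.
- by near: n; exact: hball.
Unshelve. all: by end_near.
Qed.
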